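(* Assume: (i) $A\colon\mathbb{R}^d\to\mathbb{R}^d$ is locally Lipschitz continuous and there are $\kappa\in(1,\infty)$ and $C_{\mathrm{diss}},C_2\in(0,\infty)$ such that $\langle A(x),x\rangle\le -C_{\mathrm{diss}}\|x\|^{1+\kappa}+C_2$ for all $x\in\mathbb{R}^d$; (ii) $a\colon\mathbb{R}^d\to\mathbb{R}^d$ and $b\colon\mathbb{R}^d\to\mathbb{R}^{d\times d}$ are bounded and globally Lipschitz continuous, and $\Lambda:=2C_{\mathrm{diss}}/\sup_{x}\|b(x)\|^2\in(0,\infty)$; (iii) there is $L\in(0,\infty)$ with $\langle A(x)-A(y),x-y\rangle\le L\|x-y\|^2$ for all $x,y\in\mathbb{R}^d$; (iv) $A\in C^2(\mathbb{R}^d,\mathbb{R}^d)$, there are $\chi\in[0,\infty)$ and $C_3\in(0,\infty)$ with $\|A_x(x)\|\le C_3(1+\|x\|^\chi)$ for all $x\in\mathbb{R}^d$, and there are $\varepsilon,C_4\in(0,\infty)$ such that for all $x\in\mathbb{R}^d$ and all $\varphi=(\varphi^1,\dots,\varphi^d)^T\in\mathbb{R}^d$ $$\varepsilon\|\varphi\|\sum_{k=1}^d\|A^k_{xx}(x)\|\,|\varphi^k|+\langle A_x(x)\varphi,\varphi\rangle\le C_4\|\varphi\|^2.$$ Let $X^n$ be the splitting scheme (without jump part) with step size $h_n=T/n$ started at $x$. Then for any $T\in(0,\infty)$ and $\lambda\in(0,\Lambda)$ there is a constant $C\in(0,\infty)$ such that $$\limsup_{n\to\infty}\sup_{t\in[0,T]}\mathbf{E}\Big[e^{\frac{\lambda}{1+\kappa}\|X^n_t\|^{1+\kappa}}\Big]\le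 C\,e^{\frac{\lambda}{1+\kappa}\|x\|^{1+\kappa}},\quad x\in\mathbb{R}^d,$$ and for any $T\in(0,\infty)$ and $\lambda\in(0,\frac\Lambda2)$ there is a constant $C\in(0,\infty)$ such that $$\limsup_{n\to\infty}\mathbf{E}\Big[\sup_{t\in[0,T]}e^{\frac{\lambda}{1+\kappa}\|X^n_t\|^{1+\kappa}}\Big]\le C\,e^{\frac{\lambda}{1+\kappa}\|x\|^{1+\kappa}},\quad x\in\mathbb{R}^d.$$
   Context: $d\in\mathbb{N}$; $B$ is a standard $d$-dimensional Brownian motion. $\|\cdot\|$ is the Euclidean norm on vectors and the Frobenius norm on matrices. $A_x$ is the Jacobi matrix of $A$ and $A^k_{xx}$ is the Hesse matrix of the $k$-th component $A^k$ of $A$. Flow: $\Phi=\Phi(t,x)$, $t\in[0,\infty)$, $x\in\mathbb{R}^d$, is the unique solution of $\dot\Phi(t,x)=A(\Phi(t,x))$, $\Phi(0,x)=x$. Splitting scheme (continuous case, no jumps): for $T\in(0,\infty)$ and $n\in\mathbb{N}$ put $h_n=T/n$, $t^n_k=kh_n$, $\eta^n_0=0$, $\eta^n_t=t^n_k$ for $t\in(t^n_k,t^n_{k+1}]$, $\delta^n_t=t-\eta^n_t$, $B^n_t=B_t-B_{\eta^n_t}$, $X^{(n)}_t=X^n_{\eta^n_t}$. The process $X^n$ is defined recursively by $X^n_0=x$, $Y^n_t=X^{(n)}_t+a(X^{(n)}_t)\delta^n_t+b(X^{(n)}_t)B^n_t$, $X^n_t=\Phi(\delta^n_t,Y^n_t)$,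 $t\in[0,T]$. *)

(* Defs.v *)
From HB Require Import structures.
From mathcomp Require Import all_boot all_order all_algebra archimedean.
From mathcomp Require Import all_classical all_reals all_analysis.

Set Implicit Arguments.
Unset Strict Implicit.
Unset Printing Implicit Defensive.

Import Order.TTheory GRing.Theory Num.Theory.
Import numFieldNormedType.Exports.

Local Open Scope classical_set_scope.
Local Open Scope ring_scope.

(* Elements of R^d are row vectors, because the library's Jacobian ['J f x] is
   defined for maps between row vectors.  It acts on the right, so that A_x(x) phi
   is [phi *m 'J A x]. *)

Definition dotp (R : realType) (d : nat) (x y : 'rV[R]_d) : R :=
  \sum_(i < d) x 0 i * y 0 i.

(* The norm [`|M|] of the library on matrices is the maximum norm. *)
Definition frobenius (R : realType) (m n : nat) (M : 'M[R]_(m, n)) : R :=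
  Num.sqrt (\sum_(i < m) \sum_(j < n) M i j ^+ 2).

Definition enorm (R : realType) (d : nat) (x : 'rV[R]_d) : R := frobenius x.

Definition hessian (R : realType) (d : nat) (f : 'rV[R]_d -> R) (x : 'rV[R]_d) :
    'M[R]_d :=
  \matrix_(i, j)
    derive (fun y => derive f y (delta_mx 0 j)) x (delta_mx 0 i).

Definition C2 (R : realType) (d : nat) (A : 'rV[R]_d -> 'rV[R]_d) : Prop :=
  [/\ forall x, differentiable A x,
      forall x, differentiable (jacobian A) x &
      forall k : 'I_d, continuous (hessian (fun y => A y 0 k))].

Definition locally_lipschitz (R : realType) (d : nat)
    (A : 'rV[R]_d -> 'rV[R]_d) : Prop :=
  forall x : 'rV[R]_d, exists2 U, nbhs x U &
    exists K : R, forall y z, U y -> U z -> enorm (A y - A z) <= K * enorm (y - z).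

Definition globally_lipschitz (R : realType) (d m n : nat)
    (f : 'rV[R]_d -> 'M[R]_(m, n)) : Prop :=
  exists K : R, forall y z, frobenius (f y - f z) <= K * enorm (y - z).

Definition bounded_map (R : realType) (d m n : nat)
    (f : 'rV[R]_d -> 'M[R]_(m, n)) : Prop :=
  exists K : R, forall y, frobenius (f y) <= K.

(* Time runs over [0, oo): at time 0 the derivative is the right derivative, and
   the values of [Phi] at negative times are irrelevant. *)
Definition is_flow (R : realType) (d : nat) (A : 'rV[R]_d -> 'rV[R]_d)
    (Phi : R -> 'rV[R]_d -> 'rV[R]_d) : Prop :=
  forall x,
    [/\ Phi 0 x = x,
        h^-1 *: (Phi h x - Phi 0 x) @[h --> 0^'+] --> A (Phi 0 x) &
        forall t : R, 0 < t -> is_derive t 1 (fun s => Phi s x) (A (Phi t x))].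

Definition mutually_independent (d d' : measure_display) (T : measurableType d)
    (T' : measurableType d') (R : realType) (P : probability T R)
    (I : finType) (X : I -> T -> T') : Prop :=
  forall V : I -> set T', (forall i, measurable (V i)) ->
    P (\bigcap_i X i @^-1` V i) = (\prod_i P (X i @^-1` V i))%E.

Definition borel_rV (R : realType) (d : nat) :=
  g_sigma_algebraType (@open 'rV[R]_d).

(* Only the values [B t] with [0 <= t] are relevant. *)
Definition brownian_motion (R : realType) (d : nat) (disp : measure_display)
    (Omega : measurableType disp) (P : probability Omega R)
    (B : R -> Omega -> 'rV[R]_d) : Prop :=
  [/\ forall t, 0 <= t -> measurable_fun setT (B t : Omega -> borel_rV R d),
      {ae P, forall w, B 0 w = 0 /\
                       {within `[0, +oo[, continuous (fun t => B t w)}},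
      forall (m : nat) (t : nat -> R), 0 <= t 0%N ->
        (forall k, t k <= t k.+1) ->
        mutually_independent P (fun (k : 'I_m) (w : Omega) =>
          (B (t k.+1) w - B (t k) w : borel_rV R d)) &
      forall s t : R, 0 <= s -> s < t ->
        mutually_independent P (fun (i : 'I_d) w => (B t w - B s w) 0 i) /\
        forall (i : 'I_d) (V : set R), measurable V ->
          P ((fun w => (B t w - B s w) 0 i) @^-1` V) =
          normal_prob 0 (Num.sqrt (t - s)) V].

Section splitting.
Variables (R : realType) (d : nat).
Variables (Phi : R -> 'rV[R]_d -> 'rV[R]_d).
Variables (a : 'rV[R]_d -> 'rV[R]_d) (b : 'rV[R]_d -> 'M[R]_d).

(* One step from the value [z] at time [s] to time [t], along the path [B]; the
   column vector b(z)(B_t - B_s) is transposed into a row vector. *)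
Definition splitting_step (B : R -> 'rV[R]_d) (z : 'rV[R]_d) (s t : R) :=
  Phi (t - s) (z + (t - s) *: a z + (B t - B s) *m (b z)^T).

(* The number k such that k h < t <= (k + 1) h, and 0 if t = 0; see
   [grid_indexP] *)
Definition grid_index (h t : R) : nat := `|Num.ceil (t / h)|%N.-1.

Definition eta (h t : R) : R := (grid_index h t)%:R * h.

Fixpoint splitting_node (h : R) (x : 'rV[R]_d) (B : R -> 'rV[R]_d) (k : nat) :=
  if k is k'.+1 then
    splitting_step B (splitting_node h x B k') (k'%:R * h) (k%:R * h)
  else x.

Definition splitting (T : R) (n : nat) (x : 'rV[R]_d) (B : R -> 'rV[R]_d) (t : R) :=
  let h := T / n%:R in
  splitting_step B (splitting_node h x B (grid_index h t)) (eta h t) t.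

Lemma grid_index0 h : grid_index h 0 = 0%N.
Proof. by rewrite /grid_index mul0r ceil0. Qed.

Lemma grid_indexP h t k : 0 < h -> k%:R * h < t -> t <= k.+1%:R * h ->
  grid_index h t = k.
Proof.
move=> h0 kt tk; rewrite /grid_index.
suff -> : Num.ceil (t / h) = k.+1%:Z by [].
apply: ceil_def; rewrite ltr_pdivlMr// ler_pdivrMr//.
by rewrite -addn1 PoszD addrK -PoszD addn1 -!pmulrn kt tk.
Qed.

(* The scheme satisfies the recursion X_0 = x,
   X_t = Phi(delta_t, X_eta + a(X_eta) delta_t + b(X_eta) (B_t - B_eta)). *)
Lemma splitting0 T n x B : Phi 0 x = x -> splitting T n x B 0 = x.
Proof.
move=> P0; rewrite /splitting /eta grid_index0 /= mul0r /splitting_step.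
by rewrite !subrr scale0r mul0mx !addr0.
Qed.

Lemma splittingE T n x B t : 0 < T -> (0 < n)%N -> 0 < t -> Phi 0 x = x ->
  splitting T n x B t =
  splitting_step B (splitting T n x B (eta (T / n%:R) t)) (eta (T / n%:R) t) t.
Proof.
move=> T0 n0 t0 P0; rewrite {1}/splitting; congr splitting_step.
rewrite /eta; case: (grid_index _ t) => [|k] /=.
  by rewrite mul0r splitting0.
have h0 : 0 < T / n%:R by rewrite divr_gt0// ltr0n.
rewrite /splitting /eta (@grid_indexP _ _ k)//.
by rewrite ltr_pM2r// ltr_nat.
Qed.

End splitting.

(* Main.v *)
Require Import Defs.
From HB Require Import structures.
From mathcomp Require Import ring lra.
From mathcomp Require Import all_boot all_order all_algebra archimedean.
From mathcomp Require Import all_classical all_reals all_analysis.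
From mathcomp Require Import measurable_realfun.

(** Write [be = (1 + kappa) / 2] and let [nu] be the scale for which, with
    [t = nu |y|^2], the exponent [lambda / (1 + kappa) * |y|^(1 + kappa)] is
    [t `^ be]. The exponential of [t `^ be] reacts to a Gaussian step in a
    complicated way, whereas exponentials of multiples of [t] stay in their class.
    Since [t `^ be] is convex, it is the upper envelope of its tangents, and the sum
    of the exponentials of the tangents at the points where [t `^ be] is [k^2], for
    [k = 0, 1, 2, ...], is comparable to the exponential of [t `^ be] from both sides:
    away from its own point each tangent leaves a gap that is quadratic in the
    distance ([mixture_upper], [mixture_lower]).

    Let [eta] satisfy [sup |b|^2 < 2 eta] and [eta * lambda < Cdiss], which is possible
    exactly because [lambda < Lambda]. The [mixture] at time [tau] is this sum after a
    heat flow of covariance [2 eta] has run backwards for a time [tau]. Two facts are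
    exact for every step size and uniform in the state, so that no expansion in the
    step size and no control of rare large values is needed.
    - A drift and noise step of duration [dl] advances [tau] by [dl], at the price of
      a factor [exp (K dl)] ([mixture_gaussian_step]). Indeed the artificial
      covariance exceeds the actual one, and the difference pays for the drift.
    - The flow for a duration [s] turns [tau] back from [s] to [0], at the price of a
      factor [exp (K' s)] ([flow_mixture]). By dissipativity the derivative of the
      terms with [k] up to slightly more than the current size [j], with [j^2 =
      t `^ be], is negative unless [k] is bounded; the other terms are negligible
      against the one of index [floor j] ([mixture_generator]).

    Hence the mixture, discounted by these factors, is a positive supermartingale
    along the scheme observed on any grid that refines its steps
    ([fine_scheme_maximal]). A positive supermartingale has a running maximum with
    finite moments of every order [p < 1] ([chain_maximal_le]). Applied with an
    exponent [l'] between [lambda] and [Lambda], and with [p = lambda / l'], this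
    bounds the expectation of the supremum over the grid; refining the grid and
    letting the number of terms grow, Fatou's lemma and the right-continuity of the
    paths give the supremum over all times ([splitting_sup_bound]). Both claims of
    the theorem follow, for every [lambda < Lambda]. *)

Set Implicit Arguments.
Unset Strict Implicit.
Unset Printing Implicit Defensive.

Import Order.TTheory GRing.Theory Num.Theory.
Import numFieldNormedType.Exports.

Local Open Scope classical_set_scope.
Local Open Scope ring_scope.

(** * Elementary inequalities and limits *)

Lemma powR_le_bernoulli (R : realType) (x th : R) :
  0 < x -> 0 <= th <= 1 -> x `^ th <= 1 + th * (x - 1).
Proof.
move=> x0 /andP[th0 th1].
rewrite /powR gt_eqF//.
have := @convex_expR R (Itv01 th0 th1) (ln x) 0.
rewrite !convRE /= expR0 mulr0 addr0 lnK// mulr1 /unstable.onem => h.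
by apply: le_trans h _; lra.
Qed.

Lemma powR_ge_log (R : realType) (x b : R) :
  0 < x -> 0 <= b -> 1 + b * (1 - x^-1) <= x `^ b.
Proof.
move=> x0 b0; rewrite /powR gt_eqF//.
have h1 := @expR_ge1Dx R (b * ln x).
apply: le_trans h1; rewrite lerD2l ler_wpM2l//.
have h2 := @expR_ge1Dx R (- ln x).
rewrite expRN lnK// in h2.
by lra.
Qed.

Lemma cvg_sum_ord (R : realType) (T : Type) (F : set_system T) {FF : Filter F}
    (n : nat) (f : 'I_n -> T -> R) (l : 'I_n -> R) :
  (forall i, f i x @[x --> F] --> l i) ->
  (\sum_(i < n) f i x) @[x --> F] --> \sum_(i < n) l i.
Proof.
elim: n f l => [|n IH] f l fl.
  rewrite big_ord0 (_ : (fun x => _) = cst 0); first exact: cvg_cst.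
  by apply/funext => x; rewrite big_ord0.
rewrite big_ord_recr (_ : (fun x => _) =
    (fun x => \sum_(i < n) f (widen_ord (leqnSn n) i) x + f ord_max x)); last first.
  by apply/funext => x; rewrite big_ord_recr.
by apply: cvgD; [exact: IH|exact: fl].
Qed.

(** * Quadratic gaps between a square and its tangents *)

(** The quadratic gap between a square and the tangents below it, per unit of
    [(j - k)^2]; see [gap_ge]. *)
Definition gapc (R : realType) (be : R) : R := Num.min 1 (be - 1).

Lemma gapc_gt0 (R : realType) (be : R) : 1 < be -> 0 < gapc be.
Proof. by move=> be1; rewrite /gapc lt_min; apply/andP; split; lra. Qed.

Lemma powR_homog (R : realType) (b j k : R) : 0 <= j -> 0 < k ->
  k `^ (2 - b) * j `^ b = k ^+ 2 * (j / k) `^ b.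
Proof.
move=> j0 k0; rewrite powRM// ?invr_ge0 ?ltW//.
rewrite -[k^-1]powR_inv1 ?ltW// -powRrM mulN1r powRN.
rewrite powRB ?(gt_eqF k0) ?implybT// (@powR_mulrn _ k 2) ?ltW//.
by rewrite mulrAC mulrA.
Qed.

(** By homogeneity the claim is [be x^b <= x^2 + be - 1 - gapc be (x - 1)^2] for
    [x = j / k]. Bernoulli's inequality, for the exponent [b] or [b - 1] according to
    which lies in [[0, 1]], reduces it to quadratic polynomials. *)
Lemma gap_ge (R : realType) (be b j k : R) : 1 < be -> be * b = 2 ->
  0 <= j -> 0 <= k ->
  be * (k `^ (2 - b) * j `^ b) - (be - 1) * k ^+ 2 <=
  j ^+ 2 - gapc be * (j - k) ^+ 2.
Proof.
move=> be1 beb j0; have b0 : 0 < b by nra.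
have b2 : b < 2 by nra.
rewrite le_eqVlt => /predU1P[<-|k0].
  rewrite powR0 ?gt_eqF ?subr_gt0// mul0r !mulr0 expr0n/= mulr0 subrr subr0.
  have : gapc be <= 1 by rewrite ge_min lexx.
  by have := sqr_ge0 j; nra.
move: j0; rewrite le_eqVlt => /predU1P[<-|j0].
  rewrite powR0 ?gt_eqF// !mulr0 expr0n/= !sub0r sqrrN.
  have : gapc be <= be - 1 by rewrite ge_min lexx orbT.
  by have := sqr_ge0 k; nra.
rewrite powR_homog ?(ltW j0)//.
have x0 : 0 < j / k by rewrite divr_gt0.
have -> : j = k * (j / k) by rewrite mulrC divfK// gt_eqF.
rewrite [k * _ / k]mulrAC divff ?gt_eqF// mul1r.
move: (j / k) x0 => x x0.
have c1 : gapc be <= 1 by rewrite ge_min lexx.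
have c2 : gapc be <= be - 1 by rewrite ge_min lexx orbT.
suff h : be * x `^ b <= x ^+ 2 + (be - 1) - gapc be * (x - 1) ^+ 2.
  have k2 := sqr_ge0 k.
  rewrite (_ : k * x - k = k * (x - 1)); last by ring.
  have := ler_wpM2l k2 h; rewrite !exprMn.
  by move: (x `^ b) (gapc be) => X c; lra.
have [b_le1|b_gt1] := leP b 1.
  have := @powR_le_bernoulli _ x b x0; rewrite b_le1 ltW// => /(_ isT) h.
  by have := sqr_ge0 (x - 1); nra.
have b1 : 0 <= b - 1 <= 1 by lra.
have h := powR_le_bernoulli x0 b1.
have -> : x `^ b = x * x `^ (b - 1) by rewrite mulr_powRB1// ltW.
have h2 : be * (x * x `^ (b - 1)) <= be * (x * (1 + (b - 1) * (x - 1))).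
  by rewrite ler_pM2l ?ler_pM2l//; lra.
have := sqr_ge0 (x - 1); nra.
Qed.

(** With [x = j / k] again, the bound [1 - 1 / x <= ln x] keeps the defect below
    [3 k^2 (x - 1)^2 = 3 (j - k)^2]. *)
Lemma gap_le (R : realType) (be b j k : R) : 1 < be -> be * b = 2 ->
  0 < k -> k <= j -> j <= k + 1 ->
  j ^+ 2 - 3 <= be * (k `^ (2 - b) * j `^ b) - (be - 1) * k ^+ 2.
Proof.
move=> be1 beb k0 kj jk1; have b0 : 0 < b by nra.
have j0 : 0 < j by apply: lt_le_trans kj.
rewrite powR_homog ?(ltW j0)//.
have h3 : (j - k) ^+ 2 <= 1.
  by rewrite expr_le1 ?subr_ge0//; lra.
have x1 : 1 <= j / k by rewrite ler_pdivlMr ?mul1r.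
have ej : j = k * (j / k) by rewrite mulrC divfK// gt_eqF.
move: h3; rewrite ej [k * _ / k]mulrAC divff ?gt_eqF// mul1r.
move: (j / k) x1 => x x1.
rewrite (_ : k * x - k = k * (x - 1)); last by ring.
rewrite !exprMn => h3.
have x0 : 0 < x by apply: lt_le_trans x1.
have h := powR_ge_log x0 (ltW b0).
have h2 : x ^+ 2 + (be - 1) - 3 * (x - 1) ^+ 2 <= be * x `^ b.
  have : be * (1 + b * (1 - x^-1)) <= be * x `^ b by rewrite ler_pM2l//; lra.
  apply: le_trans; rewrite mulrDr mulrA beb mulr1.
  rewrite -subr_ge0 (_ : _ - _ = 2 * (x - 1) ^+ 3 / x); last by field; rewrite gt_eqF.
  by rewrite divr_ge0 ?(ltW x0)// mulr_ge0// exprn_ge0// subr_ge0.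
have := ler_wpM2l (sqr_ge0 k) h2; have := ler_wpM2l (sqr_ge0 k) h2.
by move: (x `^ b) h3 => X; lra.
Qed.

(** * Mixtures of exponentials *)

Section mixture_definition.
Variables (R : realType) (d : nat) (th be : R).

(** The slope of [t |-> t `^ be] at [t = k `^ (2 / be)], the point where this power
    equals [k ^+ 2]. *)
Definition slope (k : nat) : R := be * k%:R `^ (2 - 2 / be).

Definition shrink (k : nat) (tau : R) : R := (1 + th * slope k * tau)^-1.

(** The exponential of the tangent at [k `^ (2 / be)], for [t = nu |y|^2], after a
    heat flow of covariance [2 eta] per unit of time has run backwards for a time
    [tau], where [th = 4 eta nu]. The exact prefactor is [shrink ^ (d / 2)]; the
    power [d] suffices and matches the bound [normal_prob_exp_quadratic]. *)
Definition mix_term (k : nat) (tau t : R) : R :=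
  expR (- ((be - 1) * k%:R ^+ 2)) *
  (shrink k tau ^+ d * expR (slope k * t * shrink k tau)).

Definition mixture (N : nat) (tau t : R) : R :=
  \sum_(k < N) mix_term k tau t.

(** The tangent itself: [t |-> t `^ be] takes the value [k ^+ 2] at its base point. *)
Definition mix_exponent (k : nat) (t : R) : R :=
  slope k * t - (be - 1) * k%:R ^+ 2.

End mixture_definition.

Section mixture_bounds.
Context {R : realType}.
Implicit Types (th be tau t j : R) (d k N : nat).

Lemma half_exponent be : 1 < be -> be * (2 / be) = 2.
Proof. by move=> be1; rewrite mulrC divfK// gt_eqF// (lt_trans ltr01). Qed.

Lemma slope_ge0 be k : 1 < be -> 0 <= slope be k.
Proof. by move=> be1; rewrite mulr_ge0 ?powR_ge0//; lra. Qed.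

Lemma slope0 be : 1 < be -> slope be 0 = 0.
Proof.
move=> be1; rewrite /slope powR0 ?mulr0// gt_eqF//.
by have := half_exponent be1; nra.
Qed.

Lemma slope_le be k : 1 < be -> slope be k <= be * k%:R ^+ 2.
Proof.
move=> be1; case: k => [|k]; first by rewrite slope0// expr0n/= mulr0.
rewrite ler_pM2l; last by lra.
rewrite -(@powR_mulrn _ _ 2)// ler_powR ?ler1n//.
by have := half_exponent be1; nra.
Qed.

Lemma shrink_den th be k tau : 1 < be -> 0 <= th -> 0 <= tau ->
  1 <= 1 + th * slope be k * tau.
Proof.
by move=> be1 th0 tau0; rewrite lerDl (mulr_ge0 (mulr_ge0 th0 (slope_ge0 k be1))).
Qed.

Lemma shrink_gt0 th be k tau : 1 < be -> 0 <= th -> 0 <= tau ->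
  0 < shrink th be k tau.
Proof.
by move=> *; rewrite invr_gt0 (lt_le_trans ltr01)// shrink_den.
Qed.

Lemma shrink_le1 th be k tau : 1 < be -> 0 <= th -> 0 <= tau ->
  shrink th be k tau <= 1.
Proof.
by move=> *; rewrite invf_le1 ?(lt_le_trans ltr01)// shrink_den.
Qed.

Lemma mix_term_gt0 d th be k tau t : 1 < be -> 0 <= th -> 0 <= tau ->
  0 < mix_term d th be k tau t.
Proof.
by move=> *; rewrite !mulr_gt0 ?expR_gt0// exprn_gt0// shrink_gt0.
Qed.

Lemma mix_term0 d th be k t :
  mix_term d th be k 0 t = expR (mix_exponent be k t).
Proof.
by rewrite /mix_term /shrink mulr0 addr0 invr1 expr1n mul1r mulr1 -expRD addrC.
Qed.

Lemma le_mix_term_mixture d th be k N tau t : 1 < be -> 0 <= th -> 0 <= tau ->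
  (k < N)%N -> mix_term d th be k tau t <= mixture d th be N tau t.
Proof.
move=> be1 th0 tau0 kN.
rewrite /mixture (bigD1 (Ordinal kN))//= lerDl sumr_ge0// => i _.
by rewrite ltW// mix_term_gt0.
Qed.

Lemma mixture_ge0 d th be N tau t : 1 < be -> 0 <= th -> 0 <= tau ->
  0 <= mixture d th be N tau t.
Proof. by move=> *; rewrite sumr_ge0// => i _; rewrite ltW// mix_term_gt0. Qed.

Lemma mixture_ge1 d th be N tau t : 1 < be -> 0 <= th -> 0 <= tau ->
  1 <= mixture d th be N.+1 tau t.
Proof.
move=> be1 th0 tau0; apply: le_trans (le_mix_term_mixture d _ be1 th0 tau0 (ltn0Sn _)).
rewrite /mix_term /shrink slope0//.
by rewrite expr0n/= !(mulr0, mul0r) addr0 invr1 expr1n oppr0 expR0 !mulr1.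
Qed.

Lemma mix_exponent_le be k j : 1 < be -> 0 <= j ->
  mix_exponent be k (j `^ (2 / be)) <= j ^+ 2 - gapc be * (j - k%:R) ^+ 2.
Proof.
move=> be1 j0; rewrite /mix_exponent /slope -mulrA.
exact: gap_ge (half_exponent be1) _ _.
Qed.

Lemma mix_exponent_trunc be j : 1 < be -> 0 <= j ->
  j ^+ 2 - 3 <= mix_exponent be (Num.truncn j) (j `^ (2 / be)).
Proof.
move=> be1 j0; rewrite /mix_exponent; have /andP[kj jk] := truncn_itv j0.
case: (posnP (Num.truncn j)) kj jk => [->|k0 kj jk].
  rewrite slope0// mul0r expr0n/= mulr0 subrr => _ j1; rewrite subr_le0.
  by nra.
rewrite /slope -mulrA; apply: gap_le (half_exponent be1) _ _ _ => //.
  by rewrite ltr0n.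
by rewrite -natr1 in jk; exact: ltW.
Qed.

Lemma slope_mono be J k : 1 < be -> (J <= k)%N -> slope be J <= slope be k.
Proof.
move=> be1 Jk; rewrite ler_wpM2l ?ge0_ler_powR ?nnegrE ?ler_nat//; first by lra.
by have := half_exponent be1; nra.
Qed.

(** Shrinking by the factor [1 / (1 + th s tau)] hits the larger slopes harder,
    so it can only improve the comparison of a term with an earlier one. *)
Lemma mix_term_ratio d th be J k tau t : 1 < be -> 0 <= th -> 0 <= tau ->
  0 <= t -> (J <= k)%N ->
  mix_term d th be k tau t <=
  expR (mix_exponent be k t - mix_exponent be J t) * mix_term d th be J tau t.
Proof.
move=> be1 th0 tau0 t0 Jk.
have sJk := slope_mono be1 Jk; have sJ := slope_ge0 J be1.
have ik := shrink_gt0 k be1 th0 tau0; have iJ := shrink_gt0 J be1 th0 tau0.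
have ikJ : shrink th be k tau <= shrink th be J tau.
  rewrite lef_pV2 ?posrE ?(lt_le_trans ltr01) ?shrink_den//.
  by rewrite lerD2l ler_wpM2r// ler_wpM2l.
have lip : slope be k * shrink th be k tau - slope be J * shrink th be J tau <=
    slope be k - slope be J.
  have := shrink_den k be1 th0 tau0; have := shrink_den J be1 th0 tau0.
  rewrite /shrink; move: (slope be k) (slope be J) sJk sJ => s r sr r0 dr ds.
  rewrite -subr_ge0 (_ : _ - _ = (s - r) *
    (((1 + th * s * tau) * (1 + th * r * tau) - 1) /
     ((1 + th * s * tau) * (1 + th * r * tau)))).
    apply: mulr_ge0; first by rewrite subr_ge0.
    by apply: divr_ge0; rewrite ?subr_ge0 ?mulr_ege1// mulr_ge0// (le_trans ler01).
  by field; rewrite !gt_eqF ?(lt_le_trans ltr01).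
rewrite /mix_term.
rewrite [leLHS]mulrCA [leRHS]mulrA [leRHS]mulrCA.
apply: ler_pM.
- by rewrite exprn_ge0// ltW.
- by rewrite mulr_ge0 ?expR_ge0.
- by rewrite lerXn2r// nnegrE ltW.
rewrite -!expRD ler_expR /mix_exponent.
have := ler_wpM2l t0 lip; lra.
Qed.

End mixture_bounds.

(** * Comparison of a mixture with the exponential of the square *)

Section mixture_sums.
Context {R : realType}.
Implicit Types (th be tau t j c q : R) (d k N : nat).

(** In truncated subtraction [(k - J.+1) + (J - k)] is the distance from [k] to the
    pair [J, J.+1], a lower bound for the distance to any point in between. *)
Lemma sum_geometric_two_sided q N (J : nat) : 0 <= q < 1 ->
  \sum_(k < N) q ^+ ((k - J.+1) + (J - k)) <= 2 / (1 - q).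
Proof.
move=> /andP[q0 q1]; have q1' : 0 < 1 - q by rewrite subr_gt0.
have left_part : forall M, (M <= J.+1)%N ->
    \sum_(k < M) q ^+ ((k - J.+1) + (J - k)) <= q ^+ (J.+1 - M) / (1 - q).
  elim=> [_|M IH MJ]; first by rewrite big_ord0 divr_ge0 ?exprn_ge0// ltW.
  rewrite big_ord_recr/=; apply: le_trans (lerD (IH (ltnW MJ)) (lexx _)) _.
  have -> : (M - J.+1 = 0)%N by apply/eqP; rewrite subn_eq0 ltnW.
  rewrite add0n subSS subSn// exprS -{2}[q ^+ (J - M)](divfK (lt0r_neq0 q1')).
  by rewrite -mulrA mulrC -subr_ge0 le_eqVlt; apply/orP; left; apply/eqP; field; lra.
have right_part : forall m,
    \sum_(k < J.+1 + m) q ^+ ((k - J.+1) + (J - k)) <= (2 - q ^+ m) / (1 - q).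
  elim=> [|m IH].
    rewrite addn0 expr0; have := left_part _ (leqnn J.+1); rewrite subnn expr0.
    by rewrite (_ : 2 - 1 = 1 :> R)//; ring.
  rewrite addnS big_ord_recr/=; apply: le_trans (lerD IH (lexx _)) _.
  have -> : (J - (J.+1 + m) = 0)%N by apply/eqP; rewrite subn_eq0 addSnnS leq_addr.
  rewrite addKn addn0 exprS.
  by rewrite le_eqVlt; apply/orP; left; apply/eqP; field; lra.
have [NJ|/ltnW JN] := leqP N J.+1.
  apply: le_trans (left_part _ NJ) _; rewrite ler_pM2r ?invr_gt0//.
  by apply: (@le_trans _ _ 1); [rewrite exprn_ile1// ltW|lra].
rewrite -(subnKC JN); apply: le_trans (right_part _) _.
by rewrite ler_pM2r ?invr_gt0// gerBl exprn_ge0.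
Qed.

Lemma sum_gaussian_le c : 0 < c -> exists2 C : R, 0 < C &
  forall N j, 0 <= j -> \sum_(k < N) expR (- (c * (j - k%:R) ^+ 2)) <= C.
Proof.
move=> c0; set q := expR (- c).
have q01 : 0 <= q < 1 by rewrite expR_ge0/= expR_lt1 oppr_lt0.
exists (2 / (1 - q)).
  by rewrite divr_gt0// subr_gt0; case/andP: q01.
move=> N j j0; apply: le_trans (sum_geometric_two_sided N (Num.truncn j) q01).
apply: ler_sum => k _; set J := Num.truncn j.
have /andP[Jj jJ] := truncn_itv j0; rewrite -/J in Jj jJ.
rewrite /q -expRM_natl ler_expR mulrN lerN2 mulrC ler_wpM2l ?(ltW c0)//.
have l2 : forall l : nat, (l%:R : R) <= l%:R ^+ 2.
  by move=> l; rewrite -natrX ler_nat -mulnn; case: l => // l; rewrite leq_pmulr.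
apply: le_trans (l2 _) _.
have [kJ|Jk] := leqP k J.
  have -> : (k - J.+1 = 0)%N by apply/eqP; rewrite subn_eq0 ltnW.
  rewrite add0n lerXn2r ?nnegrE ?subr_ge0//.
    by rewrite (le_trans _ Jj)// ler_nat.
  by rewrite natrB// lerD2r.
have -> : (J - k = 0)%N by apply/eqP; rewrite subn_eq0 ltnW.
rewrite addn0 -[leRHS]sqrrN opprB lerXn2r ?nnegrE ?subr_ge0//.
  by rewrite (le_trans (ltW jJ))// ler_nat.
by rewrite natrB// lerD2l lerN2 ltW.
Qed.

Lemma sum_quartic_gaussian_le c : 0 < c -> exists2 C : R, 0 < C &
  forall N, \sum_(k < N) (k%:R ^+ 4 * expR (- (c * k%:R ^+ 2)) : R) <= C.
Proof.
move=> c0; have [C C0 HC] := sum_gaussian_le (divr_gt0 c0 (ltr0Sn R 1)).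
exists (16 / c ^+ 2 * C); first by rewrite mulr_gt0// divr_gt0// exprn_gt0.
move=> N; apply: le_trans (ler_wpM2l _ (HC N 0 (lexx 0))); last first.
  by rewrite divr_ge0// sqr_ge0.
rewrite mulr_sumr; apply: ler_sum => k _; rewrite sub0r sqrrN.
have -> : c * k%:R ^+ 2 = c / 2 * k%:R ^+ 2 + c / 2 * k%:R ^+ 2 by field.
rewrite opprD expRD mulrA ler_wpM2r ?expR_ge0//.
rewrite expRN ler_pdivrMr ?expR_gt0//.
have h := expR_ge1Dx (c / 4 * k%:R ^+ 2).
have k2 : 0 <= c / 4 * k%:R ^+ 2 :> R by rewrite mulr_ge0 ?sqr_ge0// ltW// divr_gt0.
have -> : c / 2 * k%:R ^+ 2 = c / 4 * k%:R ^+ 2 + c / 4 * k%:R ^+ 2 :> R by field.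
rewrite expRD; move: (expR _) h => E h.
have E2 : (c / 4 * k%:R ^+ 2) ^+ 2 <= E * E.
  by rewrite -expr2 lerXn2r ?nnegrE//; lra.
apply: le_trans (ler_wpM2l _ E2); last by rewrite divr_ge0// sqr_ge0.
by rewrite le_eqVlt; apply/orP; left; apply/eqP; field; rewrite gt_eqF.
Qed.

(** The tangent lines of the exponent at [j = 0, 1, 2, ...] leave a quadratic
    gap, so that boundedly many of them count at any point. *)
Lemma mixture_upper be : 1 < be -> exists2 C : R, 0 < C &
  forall d th N j, 0 <= j ->
    mixture d th be N 0 (j `^ (2 / be)) <= C * expR (j ^+ 2).
Proof.
move=> be1; have [C C0 HC] := sum_gaussian_le (gapc_gt0 be1).
exists C => // d th N j j0; apply: le_trans (ler_wpM2r (expR_ge0 _) (HC N j j0)).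
rewrite mulr_suml; apply: ler_sum => k _.
by rewrite mix_term0 -expRD ler_expR addrC mix_exponent_le.
Qed.

(** The single term of index [floor j] is already as large as the exponential of
    the square, up to a constant; this is why finitely many terms suffice at a given point. *)
Lemma mixture_lower be d th N j : 1 < be -> 0 <= th -> 0 <= j -> j < N%:R ->
  expR (j ^+ 2 - 3) <= mixture d th be N 0 (j `^ (2 / be)).
Proof.
move=> be1 th0 j0 jN; have /andP[Jj jJ] := truncn_itv j0.
have JN : (Num.truncn j < N)%N by rewrite -(ltr_nat R); apply: le_lt_trans jN.
apply: le_trans (le_mix_term_mixture d _ be1 th0 (lexx 0) JN).
by rewrite mix_term0 ler_expR mix_exponent_trunc.
Qed.

End mixture_sums.

(** * Mixtures along a dissipative path *)

Section gronwall.
Context {R : realType}.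

(** At [0] only a right limit is asked for, the flow being defined for
    nonnegative times. *)
Lemma gronwall (f f' : R -> R) (K s : R) : 0 <= s ->
  f u @[u --> 0^'+] --> f 0 ->
  (forall u, 0 < u <= s -> is_derive u 1 f (f' u)) ->
  (forall u, 0 < u <= s -> f' u <= K * f u) ->
  f s <= expR (K * s) * f 0.
Proof.
rewrite le_eqVlt => /predU1P[<- _ _ _|s0 f0 df f'le].
  by rewrite mulr0 expR0 mul1r.
pose g u := expR (- (K * u)) * f u.
have dg u : 0 < u <= s ->
    is_derive u 1 g (expR (- (K * u)) * (f' u - K * f u)).
  move=> us; have h1 := df u us.
  have h2 : is_derive u 1 (fun u => expR (- (K * u))) (- K * expR (- (K * u))).
    have h0 : is_derive u 1 (fun u : R => - (K * u)) (- K).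
      rewrite (_ : (fun u : R => _) = (- K) \*: (@id R)); last first.
        by apply/funext => v; rewrite /= -mulNr.
      by apply: is_derive_eq; rewrite scaler1.
    by rewrite mulrC; exact: (is_derive1_comp (is_derive_expR _) h0).
  have h3 := is_deriveM h2 h1.
  rewrite -[g]/((fun u : R => expR (- (K * u))) * f).
  apply: (is_derive_eq h3).
  by rewrite /GRing.scale/=; ring.
have cg : {within `[0, s], continuous g}.
  apply/(continuous_within_itvP _ s0); split.
  - move=> u; rewrite in_itv/= => /andP[u0 us].
    apply/differentiable_continuous/derivable1_diffP.
    by apply: ex_derive; apply: dg; rewrite u0 ltW.
  - apply: cvgM; last exact: f0.
    apply: cvg_at_right_filter; apply: continuous_comp.
      by apply: continuousN; apply: mulrl_continuous.
    exact: continuous_expR.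
  - apply: cvg_at_left_filter.
    apply/differentiable_continuous/derivable1_diffP.
    by apply: ex_derive; apply: dg; rewrite s0 lexx.
have : g s <= g 0.
  have s0' : 0 <= s := ltW s0.
  apply: (@ler0_derive1_le_cc _ g 0 s _ _ cg s 0); rewrite ?in_itv/= ?lexx ?s0'//.
  - move=> u; rewrite in_itv/= => /andP[u0 us].
    by apply: ex_derive; apply: dg; rewrite u0 ltW.
  - move=> u; rewrite in_itv/= => /andP[u0 /ltW us].
    have us' : 0 < u <= s by rewrite u0.
    rewrite derive1E (@derive_val _ _ _ _ _ _ _ (dg u us')).
    by rewrite mulr_ge0_le0 ?expR_ge0// subr_le0 f'le.
rewrite /g mulr0 oppr0 expR0 mul1r expRN => h.
by rewrite -ler_pdivrMl ?expR_gt0.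
Qed.

End gronwall.

Section generator.
Context {R : realType}.
Implicit Types (th be om tau t j D : R) (d k N : nat).

(** Beyond the bad indices' threshold [rho * j] the quadratic gap makes a term
    negligible against the one of index [floor j], which carries the size of the
    mixture at [j]; by [mix_term_ratio] the shrinking does not spoil this. *)
Lemma mix_term_far be rho d N (k : 'I_N) th tau j t : 1 < be -> 1 < rho ->
  0 <= th -> 0 <= tau -> 0 <= j -> rho * j < k%:R -> t = j `^ (2 / be) ->
  mix_term d th be k tau t <=
  expR 3 * expR (- (gapc be * (1 - rho^-1) ^+ 2 * k%:R ^+ 2)) *
    mixture d th be N tau t.
Proof.
move=> be1 rho1 th0 tau0 j0 jk tE.
have rho0 : 0 < rho := lt_trans ltr01 rho1.
have r1 : rho^-1 < 1 by rewrite invf_lt1.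
have jk' : j <= k%:R by apply: le_trans (ltW jk); rewrite ler_peMl// ltW.
have /andP[Jj jJ] := truncn_itv j0.
have Jk : (Num.truncn j <= k)%N by rewrite -(ler_nat R) (le_trans Jj).
have JN : (Num.truncn j < N)%N by apply: leq_ltn_trans Jk (ltn_ord k).
have t0 : 0 <= t by rewrite tE powR_ge0.
have far : gapc be * (1 - rho^-1) ^+ 2 * k%:R ^+ 2 <=
    gapc be * (j - k%:R) ^+ 2.
  rewrite -mulrA ler_pM2l ?gapc_gt0// -exprMn -[leRHS]sqrrN opprB.
  have jr : j <= rho^-1 * k%:R by rewrite ler_pdivlMl// ltW.
  rewrite lerXn2r ?nnegrE ?subr_ge0 ?mulr_ge0 ?subr_ge0 ?(ltW r1)//.
  by rewrite mulrBl mul1r lerD2l lerN2.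
have exple : mix_exponent be k t - mix_exponent be (Num.truncn j) t <=
    3 - gapc be * (1 - rho^-1) ^+ 2 * k%:R ^+ 2.
  have := mix_exponent_le k be1 j0; have := mix_exponent_trunc be1 j0.
  by rewrite -tE; move: far; clear; lra.
apply: le_trans (mix_term_ratio d be1 th0 tau0 t0 Jk) _.
apply: (ler_pM (expR_ge0 _) (ltW (mix_term_gt0 d _ t be1 th0 tau0))).
  by rewrite -expRD ler_expR.
exact: le_mix_term_mixture.
Qed.

(** One term of the generator bound.  For a good index [k <= rho * j] the bracket
    is at most [D], and it is positive only when [k] is bounded; a bad index is
    left to [mix_term_far]. *)
Lemma generator_term be om rho D : 1 < be -> 1 < rho -> rho ^+ 2 < om ->
  0 <= D -> let c := gapc be * (1 - rho^-1) ^+ 2 in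
  forall d N (k : 'I_N) th tau j, 0 <= th -> 0 <= tau -> 0 <= j ->
  forall t, t = j `^ (2 / be) ->
  mix_term d th be k tau t *
    (slope be k * shrink th be k tau *
      (D + slope be k * t - be * om * j ^+ 2)) <=
  D * (rho ^+ 2 * D / (om - rho ^+ 2)) * mix_term d th be k tau t +
  expR 3 * (be * (D + be)) * (k%:R ^+ 4 * expR (- (c * k%:R ^+ 2))) *
    mixture d th be N tau t.
Proof.
move=> be1 rho1 rhoom D0 c d N k th tau j th0 tau0 j0 t tE.
have be0 : 0 < be := lt_trans ltr01 be1.
have rho0 : 0 < rho := lt_trans ltr01 rho1.
have beD0 : 0 <= be * (D + be) by rewrite mulr_ge0 ?addr_ge0 ?(ltW be0).
have om0 : 0 <= om by apply: le_trans (ltW rhoom); exact: sqr_ge0.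
have b2 : 0 <= 2 - 2 / be by have beb := half_exponent be1; nra.
have b0 : 0 <= 2 / be by rewrite divr_ge0// ltW.
have T0 := ltW (mix_term_gt0 d k t be1 th0 tau0).
have M0 := mixture_ge0 d N t be1 th0 tau0.
have s0 := slope_ge0 k be1.
have i0 := ltW (shrink_gt0 k be1 th0 tau0).
have i1 := shrink_le1 k be1 th0 tau0.
have sk := slope_le k be1.
have si0 : 0 <= slope be k * shrink th be k tau := mulr_ge0 s0 i0.
have si1 : slope be k * shrink th be k tau <= slope be k by rewrite ler_piMr.
have st_le y : 0 <= y -> k%:R <= y -> j <= y -> slope be k * t <= be * y ^+ 2.
  move=> y0 ky jy; rewrite tE /slope -mulrA ler_pM2l// -(@powR_mulrn _ _ 2)//.
  apply: (@le_trans _ _ (y `^ (2 - 2 / be) * y `^ (2 / be))).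
    by rewrite ler_pM ?powR_ge0// ge0_ler_powR ?nnegrE.
  rewrite -powRD ?subrK//.
  by rewrite pnatr_eq0.
have small0 : 0 <= rho ^+ 2 * D / (om - rho ^+ 2).
  apply: divr_ge0; last by rewrite subr_ge0 ltW.
  exact: mulr_ge0 (sqr_ge0 _) D0.
have [kj|jk] := leP k%:R (rho * j).
  apply: ler_wpDr.
    apply: mulr_ge0 M0; apply: mulr_ge0; first exact: mulr_ge0 (expR_ge0 _) beD0.
    exact: mulr_ge0 (exprn_ge0 _ (ler0n _ _)) (expR_ge0 _).
  rewrite mulrC; apply: ler_wpM2r => //.
  have hst : slope be k * t <= be * (rho * j) ^+ 2.
    apply: st_le => //; first exact: mulr_ge0 (ltW rho0) j0.
    by rewrite ler_peMl// ltW.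
  have [neg|/ltW pos] := leP (D + slope be k * t - be * om * j ^+ 2) 0.
    by apply: le_trans (mulr_ge0 D0 small0); exact: mulr_ge0_le0.
  have hj : be * (om - rho ^+ 2) * j ^+ 2 <= D.
    by rewrite exprMn in hst; move: hst pos; clear; lra.
  have hs : slope be k <= rho ^+ 2 * D / (om - rho ^+ 2).
    apply: le_trans sk _.
    rewrite ler_pdivlMr ?subr_gt0//.
    have k2 : k%:R ^+ 2 <= (rho * j) ^+ 2 :> R.
      by rewrite lerXn2r ?nnegrE//; exact: mulr_ge0 (ltW rho0) j0.
    apply: le_trans (ler_wpM2l (sqr_ge0 rho) hj).
    have -> : rho ^+ 2 * (be * (om - rho ^+ 2) * j ^+ 2) =
       be * (rho * j) ^+ 2 * (om - rho ^+ 2) by ring.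
    by rewrite ler_pM2r ?subr_gt0// ler_pM2l.
  rewrite [leRHS]mulrC; apply: ler_pM => //; first exact: le_trans si1 hs.
  have : be * (rho * j) ^+ 2 <= be * om * j ^+ 2.
    by rewrite exprMn -mulrA ler_pM2l// ler_wpM2r ?sqr_ge0// ltW.
  by move: hst; clear; lra.
apply: ler_wpDl; first exact: mulr_ge0 (mulr_ge0 D0 small0) T0.
have k0 : (0 < k)%N.
  by rewrite -(ltr0n R) (le_lt_trans _ jk)//; exact: mulr_ge0 (ltW rho0) j0.
have k2 : 1 <= k%:R ^+ 2 :> R by rewrite expr_ge1// ler1n.
have jk' : j <= k%:R by apply: le_trans (ltW jk); rewrite ler_peMl// ltW.
have hst : slope be k * t <= be * k%:R ^+ 2 by exact: st_le.
have bek0 : 0 <= be * k%:R ^+ 2 := mulr_ge0 (ltW be0) (sqr_ge0 _).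
have poly : slope be k * shrink th be k tau *
    (D + slope be k * t - be * om * j ^+ 2) <= be * (D + be) * k%:R ^+ 4.
  apply: (@le_trans _ _ (slope be k * shrink th be k tau * (D + be * k%:R ^+ 2))).
    apply: (ler_wpM2l si0).
    have : 0 <= be * om * j ^+ 2.
      by apply: mulr_ge0 (sqr_ge0 _); exact: mulr_ge0 (ltW be0) om0.
    by move: hst; clear; lra.
  apply: (@le_trans _ _ (be * k%:R ^+ 2 * ((D + be) * k%:R ^+ 2))); last first.
    by rewrite le_eqVlt; apply/orP; left; apply/eqP; ring.
  apply: (ler_pM si0 (addr_ge0 D0 bek0) (le_trans si1 sk)).
  by rewrite mulrDl lerD2r ler_peMr.
apply: le_trans (ler_wpM2l T0 poly) _.
apply: le_trans.
  apply: ler_wpM2r (mix_term_far d be1 rho1 th0 tau0 j0 jk tE).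
  exact: mulr_ge0 beD0 (exprn_ge0 _ (ler0n _ _)).
by rewrite le_eqVlt; apply/orP; left; apply/eqP; rewrite /c; ring.
Qed.

(** The sum is the growth rate of the mixture when its clock runs backwards, which
    contributes [slope * t], while [t] decays at the rate [be * om * j ^+ 2] up to a
    constant absorbed in [D]. The condition [om > 1] leaves room for indices [k] that
    exceed [j] by a factor [rho] with [1 < rho ^+ 2 < om]. *)
Lemma mixture_generator be om D : 1 < be -> 1 < om -> 0 <= D ->
  exists2 K : R, 0 <= K &
  forall d N th tau j, 0 <= th -> 0 <= tau -> 0 <= j ->
  forall t, t = j `^ (2 / be) ->
  \sum_(k < N) mix_term d th be k tau t *
    (slope be k * shrink th be k tau *
      (D + slope be k * t - be * om * j ^+ 2)) <=
  K * mixture d th be N tau t.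
Proof.
move=> be1 om1 D0; pose rho := Num.sqrt ((1 + om) / 2).
have rho2 : rho ^+ 2 = (1 + om) / 2 by rewrite sqr_sqrtr//; lra.
have rhoom : rho ^+ 2 < om by rewrite rho2; lra.
have rho1 : 1 < rho by rewrite -sqrtr1 ltr_sqrt; lra.
pose c := gapc be * (1 - rho^-1) ^+ 2.
have c0 : 0 < c.
  by rewrite mulr_gt0 ?gapc_gt0// exprn_gt0// subr_gt0 invf_lt1//; lra.
have [C C0 HC] := sum_quartic_gaussian_le c0.
have E0 : 0 <= expR 3 * (be * (D + be)).
  by rewrite mulr_ge0 ?expR_ge0// mulr_ge0; lra.
exists (D * (rho ^+ 2 * D / (om - rho ^+ 2)) + expR 3 * (be * (D + be)) * C).
  rewrite addr_ge0//; last by rewrite mulr_ge0// ltW.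
  apply: mulr_ge0 => //; apply: divr_ge0; last by rewrite subr_ge0 ltW.
  exact: mulr_ge0 (sqr_ge0 _) D0.
move=> d N th tau j th0 tau0 j0 t tE.
apply: le_trans.
  by apply: ler_sum => k _; exact: (generator_term be1 rho1 rhoom D0 d k th0 tau0 j0 tE).
rewrite big_split/= -mulr_sumr -mulr_suml -mulr_sumr mulrDl lerD2l.
rewrite ler_wpM2r ?mixture_ge0// ler_wpM2l//; exact: HC.
Qed.

End generator.

Section mixture_along_a_path.
Context {R : realType}.
Implicit Types (th be om t D : R) (d k N : nat).

Lemma is_derive_mix_term d th be k (s : R) (f : R -> R) (u f' : R) :
  1 < be -> 0 <= th -> u <= s -> is_derive u 1 f f' ->
  is_derive u 1 (fun v => mix_term d th be k (s - v) (f v))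
    (mix_term d th be k (s - u) (f u) *
      (slope be k * shrink th be k (s - u) *
        (d%:R * th + f' + th * (slope be k * f u) * shrink th be k (s - u)))).
Proof.
move=> be1 th0 us df; set sl := slope be k.
have su0 : 0 <= s - u by rewrite subr_ge0.
have den := shrink_den k be1 th0 su0.
pose den_fun v : R := 1 + th * sl * (s - v).
have dden : is_derive u 1 den_fun (- (th * sl)).
  rewrite (_ : den_fun = cst (1 + th * sl * s) + (- (th * sl)) \*: (@id R)).
    by apply: is_derive_eq; rewrite scaler1 add0r.
  by apply/funext => v; rewrite /den_fun /= fctE /= /GRing.scale/=; ring.
have dshrink : is_derive u 1 (fun v => shrink th be k (s - v))
    (th * sl * shrink th be k (s - u) ^+ 2).
  have nz : den_fun u != 0 by rewrite gt_eqF// (lt_le_trans ltr01).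
  apply: is_derive_eq; first exact: (is_deriveV nz dden).
  by rewrite /GRing.scale/= /shrink -/sl -/(den_fun u) exprVn; ring.
have dexp : is_derive u 1 (fun v => expR (sl * f v * shrink th be k (s - v)))
   (expR (sl * f u * shrink th be k (s - u)) *
    (sl * (f u * (th * sl * shrink th be k (s - u) ^+ 2)
      + shrink th be k (s - u) * f'))).
  apply: (is_derive1_comp (is_derive_expR _)).
  rewrite (_ : (fun v => _) = sl \*: (f * (fun v => shrink th be k (s - v)))); last first.
    by apply/funext => v; rewrite /= fctE /GRing.scale/= mulrA.
  by have := is_deriveZ sl (is_deriveM df dshrink).
have dpow := is_deriveX d dshrink.
have dprod := is_deriveZ (expR (- ((be - 1) * k%:R ^+ 2))) (is_deriveM dpow dexp).
rewrite (_ : (fun v => _) = expR (- ((be - 1) * k%:R ^+ 2)) \*: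
  ((fun v => shrink th be k (s - v)) ^+ d *
   (fun v => expR (sl * f v * shrink th be k (s - v))))).
  apply: (is_derive_eq dprod).
  rewrite /GRing.scale/= /mix_term -/sl fctE.
  have -> : d%:R * shrink th be k (s - u) ^+ d.-1 *
      (th * sl * shrink th be k (s - u) ^+ 2) =
      d%:R * th * sl * shrink th be k (s - u) * shrink th be k (s - u) ^+ d.
    case: (d) => [|d']; first by rewrite !mul0r.
    by rewrite /= !exprS; ring.
  by ring.
by apply/funext => v; rewrite /mix_term /GRing.scale /= !fctE.
Qed.

Lemma continuous_mix_term d th be k (s : R) (f : R -> R) : 1 < be -> 0 <= th ->
  0 <= s -> f u @[u --> 0^'+] --> f 0 ->
  mix_term d th be k (s - u) (f u) @[u --> 0^'+] -->
  mix_term d th be k (s - 0) (f 0).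
Proof.
move=> be1 th0 s0 cf.
have cs : shrink th be k (s - u) @[u --> 0^'+] --> shrink th be k (s - 0).
  apply: cvgV.
    by rewrite gt_eqF// (lt_le_trans ltr01)// shrink_den// subr0.
  apply: cvgD; first exact: cvg_cst.
  apply: cvgM; first exact: cvg_cst.
  apply: cvg_at_right_filter.
  by apply: cvgB; [exact: cvg_cst|exact: cvg_id].
apply: cvgM; first exact: cvg_cst.
apply: cvgM.
  exact: (continuous_cvg _ (@exprn_continuous _ d _) cs).
apply: (continuous_cvg _ (@continuous_expR _ _)).
by apply: cvgM; [apply: cvgM => //; exact: cvg_cst|exact: cs].
Qed.

(** Running the mixture's clock backwards while its argument decays along
    [f' <= th * (Dc - be * om * f ^ be)] with [om > 1], its derivative is at
    most [th] times the left-hand side of [mixture_generator]: here [D] is [Dc] plus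
    the contribution [d] of the prefactors. Gronwall's lemma concludes. *)
Lemma mixture_along be om Dc th d : 1 < be -> 1 < om -> 0 <= Dc -> 0 <= th ->
  exists2 K : R, 0 <= K & forall N (s : R) (f f' : R -> R), 0 <= s ->
    (forall u, 0 <= u <= s -> 0 <= f u) ->
    f u @[u --> 0^'+] --> f 0 ->
    (forall u, 0 < u <= s -> is_derive u 1 f (f' u)) ->
    (forall u, 0 < u <= s -> f' u <= th * (Dc - be * om * f u `^ be)) ->
    mixture d th be N 0 (f s) <= expR (K * s) * mixture d th be N s (f 0).
Proof.
move=> be1 om1 Dc0 th0.
have be0 : 0 < be by apply: lt_trans be1.
have D0 : 0 <= d%:R + Dc by rewrite addr_ge0.
have [K K0 HK] := mixture_generator be1 om1 D0.
exists (th * K); first exact: mulr_ge0.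
move=> N s f f' s0 f0 cf df f'le.
pose h u := mixture d th be N (s - u) (f u).
pose h' u := \sum_(k < N) (mix_term d th be k (s - u) (f u) *
      (slope be k * shrink th be k (s - u) *
        (d%:R * th + f' u + th * (slope be k * f u) * shrink th be k (s - u)))).
suff : h s <= expR (th * K * s) * h 0 by rewrite /h subrr subr0.
apply: (@gronwall R h h') => //.
- rewrite /h /mixture; apply: cvg_sum_ord => k.
  exact: continuous_mix_term.
- move=> u /andP[u0 us].
  rewrite (_ : h = \sum_(k < N) (fun v => mix_term d th be k (s - v) (f v))).
    apply: is_derive_sum => k; apply: is_derive_mix_term => //.
    by apply: df; rewrite u0.
  by apply/funext => v; rewrite fct_sumE.
- move=> u /andP[u0 us]; rewrite /h'.
  have fu0 : 0 <= f u by apply: f0; rewrite ltW.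
  have su0 : 0 <= s - u by rewrite subr_ge0.
  pose j := f u `^ (be / 2).
  have j0 : 0 <= j by rewrite powR_ge0.
  have jE : f u = j `^ (2 / be).
    by rewrite /j -powRrM (_ : be / 2 * (2 / be) = 1) ?powRr1//; field; lra.
  have j2 : j ^+ 2 = f u `^ be.
    by rewrite -(@powR_mulrn _ _ 2)// /j -powRrM divfK.
  have := HK d N th (s - u) j th0 su0 j0 _ jE.
  move=> /(ler_wpM2l th0); rewrite !mulrA -/(h u) => le1.
  apply: le_trans le1; rewrite mulr_sumr; apply: ler_sum => k _.
  have T0 := mix_term_gt0 d k (f u) be1 th0 su0.
  have i0 := shrink_gt0 k be1 th0 su0.
  have i1 := shrink_le1 k be1 th0 su0.
  have sl0 := slope_ge0 k be1.
  rewrite [leRHS]mulrCA; apply: ler_wpM2l; first exact: ltW.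
  rewrite [leRHS]mulrCA; apply: ler_wpM2l; first by apply: mulr_ge0 => //; exact: ltW.
  have fu : 0 < u <= s by rewrite u0.
  have := f'le u fu; rewrite -j2.
  have : th * (slope be k * f u) * shrink th be k (s - u) <= th * (slope be k * f u).
    by rewrite ler_piMr// mulr_ge0// mulr_ge0.
  by lra.
Qed.

End mixture_along_a_path.

(** * Gaussian moments *)

Section density.
Local Open Scope ereal_scope.
Import HBNNSimple.

(** No integrability of [f] is assumed: the finiteness of an exponential moment is
    what this change of variables serves to prove. *)
Lemma ge0_integral_density d (T : measurableType d) (R : realType)
    (mu nu : {measure set T -> \bar R}) (p : T -> R) (f : T -> \bar R) :
  measurable_fun setT p -> (forall x, 0 <= p x)%R ->
  (forall V, measurable V -> nu V = \int[mu]_(x in V) (p x)%:E) ->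
  measurable_fun setT f -> (forall x, 0 <= f x) ->
  \int[nu]_x f x = \int[mu]_x (f x * (p x)%:E).
Proof.
move=> mp p0 nuE mf f0.
have mpE : measurable_fun setT (EFin \o p) by exact/measurable_EFinP.
pose f_ := nnsfun_approx measurableT mf.
have f_cvg x : EFin \o f_ ^~ x @ \oo --> f x.
  by apply: cvg_nnsfun_approx => // y _; exact: f0.
transitivity (limn (fun n => \int[nu]_x (f_ n x)%:E)).
  rewrite -monotone_convergence//.
  - by apply: eq_integral => x _; apply/esym/cvg_lim => //; exact: f_cvg.
  - by move=> n; exact/measurable_EFinP/measurable_funP.
  - by move=> n x _; rewrite lee_fin.
  - by move=> x _ m n mn; rewrite lee_fin; exact/lefP/nd_nnsfun_approx.
transitivity (limn (fun n => \int[mu]_x ((f_ n x)%:E * (p x)%:E))); last first.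
  rewrite -monotone_convergence//.
  - apply: eq_integral => x _; apply/cvg_lim => //.
    by apply: cvgeZr => //; exact: f_cvg.
  - move=> n; apply: emeasurable_funM => //.
    exact/measurable_EFinP/measurable_funP.
  - by move=> n x _; rewrite mule_ge0 ?lee_fin//.
  - move=> x _ m n mn; rewrite lee_wpmul2r ?lee_fin//.
    exact/lefP/nd_nnsfun_approx.
congr (limn _); apply/funext => n.
rewrite integralT_nnsfun sintegralE.
transitivity (\sum_(k \in range (f_ n))
    \int[mu]_x ((k * \1_(f_ n @^-1` [set k]) x)%:E * (p x)%:E)).
  apply: eq_fsbigr => r /[!inE] -[x _ <-].
  rewrite nuE//.
  under [RHS]eq_integral do rewrite EFinM -muleA.
  rewrite ge0_integralZl//; last 3 first.
  - by apply: emeasurable_funM => //; exact/measurable_EFinP/measurable_indic.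
  - by move=> y _; rewrite mule_ge0 ?lee_fin//.
  - by rewrite lee_fin.
  congr (_ * _); rewrite integral_mkcond; apply: eq_integral => y _.
  rewrite patchE indicE; case: ifP => _; first by rewrite mul1e.
  by rewrite mul0e.
rewrite -ge0_integral_fsum//.
- apply: eq_integral => x _; rewrite [in RHS]fimfunE -fsumEFin//.
  rewrite ge0_mule_fsuml// => k.
  by rewrite nnfun_muleindic_ge0.
- move=> r; apply: emeasurable_funM => //.
  by apply/measurable_EFinP/measurable_funM.
- move=> r x _; rewrite mule_ge0 ?lee_fin//.
  by have := nnfun_muleindic_ge0 (f_ n) r x; rewrite -EFinM lee_fin.
Qed.

End density.

Section gaussian_moment.
Context {R : realType}.

(** Completing the square: the integrand is a Gaussian density up to a
    constant, with variance enlarged by [1 / (1 - 2 g s^2)]. The exact prefactor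
    [(1 - 2 g s^2)^(-1/2)] is rounded up. *)
Lemma normal_prob_exp_quadratic (s c g : R) :
  0 < s -> 0 <= g -> 2 * g * s ^+ 2 < 1 ->
  (\int[normal_prob 0 s]_x (expR (c * x + g * x ^+ 2))%:E <=
   ((1 - 2 * g * s ^+ 2)^-1 *
    expR (c ^+ 2 * s ^+ 2 / (2 * (1 - 2 * g * s ^+ 2))))%:E)%E.
Proof.
move=> s0 g0 gs.
have [q qE] : exists q, q = 1 - 2 * g * s ^+ 2 by exists (1 - 2 * g * s ^+ 2).
rewrite -qE.
have q0 : 0 < q by rewrite qE; lra.
have q1 : q <= 1.
  by rewrite qE gerBl mulr_ge0 ?sqr_ge0// mulr_ge0.
have s2 : 0 < s ^+ 2 by rewrite exprn_gt0.
have sq0 : 0 < Num.sqrt q by rewrite sqrtr_gt0.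
have [s' s'0 s'2] : exists2 s', 0 < s' & s' ^+ 2 = s ^+ 2 / q.
  exists (s / Num.sqrt q); first by rewrite divr_gt0.
  by rewrite expr_div_n sqr_sqrtr// ltW.
pose m := c * s' ^+ 2.
pose C := expR (c ^+ 2 * s ^+ 2 / (2 * q)) / Num.sqrt q.
have mexp : measurable_fun setT (fun x : R => expR (c * x + g * x ^+ 2)).
  apply: measurableT_comp => //; apply: measurable_funD.
    exact: measurable_funM.
  by apply: measurable_funM => //; exact: measurable_funX.
rewrite (@ge0_integral_density _ _ R lebesgue_measure _ (normal_pdf 0 s))//; first last.
- exact/measurable_EFinP.
- by move=> x; exact: normal_pdf_ge0.
- exact: measurable_normal_pdf.
have square x : expR (c * x + g * x ^+ 2) * normal_pdf 0 s x =
    C * normal_pdf m s' x.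
  rewrite !normal_pdfE ?gt_eqF//= /normal_fun subr0 /C.
  have -> : expR (c * x + g * x ^+ 2) *
      (normal_peak s * expR (- x ^+ 2 / (s ^+ 2 *+ 2))) =
    normal_peak s * expR (c * x + g * x ^+ 2 + - x ^+ 2 / (s ^+ 2 *+ 2)).
    by rewrite mulrCA -expRD.
  have -> : expR (c ^+ 2 * s ^+ 2 / (2 * q)) / Num.sqrt q *
      (normal_peak s' * expR (- (x - m) ^+ 2 / (s' ^+ 2 *+ 2))) =
    normal_peak s' / Num.sqrt q *
      expR (c ^+ 2 * s ^+ 2 / (2 * q) + - (x - m) ^+ 2 / (s' ^+ 2 *+ 2)).
    by rewrite expRD mulrACA [RHS]mulrACA [normal_peak s' * _]mulrC.
  congr (_ * expR _).
    rewrite /normal_peak -invfM -sqrtrM; last first.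
      by rewrite mulrn_wge0// mulr_ge0 ?sqr_ge0 ?pi_ge0.
    congr (Num.sqrt _)^-1.
    by rewrite s'2; move: (@pi R) => z; field; rewrite gt_eqF.
  rewrite /m s'2.
  have gE : g = (1 - q) / (2 * s ^+ 2) by rewrite qE; field; rewrite gt_eqF.
  rewrite gE; field.
  by rewrite (gt_eqF q0) (gt_eqF s0).
under eq_integral do rewrite -EFinM square EFinM.
rewrite ge0_integralZl//; last 3 first.
- by apply/measurable_EFinP; exact: measurable_normal_pdf.
- by move=> x _; rewrite lee_fin normal_pdf_ge0.
- by rewrite lee_fin divr_ge0 ?expR_ge0// ltW.
rewrite integral_normal_pdf mule1 lee_fin /C mulrC ler_wpM2r ?expR_ge0//.
rewrite lef_pV2 ?posrE// -{1}(sqr_sqrtr (ltW q0)) expr2 ler_piMr ?sqrtr_ge0//.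
by rewrite -sqrtr1 ler_sqrt.
Qed.

End gaussian_moment.

(** * Chains driven by independent noise *)

Lemma integral_probability_cst d (T : measurableType d) (R : realType)
    (P : probability T R) (r : R) : (\int[P]_w r%:E = r%:E)%E.
Proof.
rewrite integral_cst// [X in (_ * X)%E](_ : _ = 1%E) ?mule1//.
exact: probability_setT.
Qed.

Section independence.
Local Open Scope ereal_scope.
Context d1 d2 d3 (Omega : measurableType d1) (S : measurableType d2)
  (T : measurableType d3) (R : realType) (P : probability Omega R).

Lemma measurable_preimageT d d' (U : measurableType d) (V : measurableType d')
  (f : U -> V) (A : set V) : measurable_fun setT f -> measurable A ->
  measurable (f @^-1` A).
Proof. by move=> mf mA; rewrite -[X in measurable X]setTI; exact: mf. Qed.

Lemma measure_unique_rectangles (m1 m2 : {measure set (S * T) -> \bar R}) :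
  m1 setT < +oo ->
  (forall A B, measurable A -> measurable B -> m1 (A `*` B) = m2 (A `*` B)) ->
  forall C, measurable C -> m1 C = m2 C.
Proof.
move=> m1oo m12.
apply: (measure_unique [set A `*` B | A in measurable & B in measurable]
  (fun=> setT)) => //.
- exact: measurable_prod_measurableType.
- move=> _ _ [A mA [B mB <-]] [A' mA' [B' mB' <-]].
  exists (A `&` A'); first exact: measurableI.
  by exists (B `&` B'); [exact: measurableI|rewrite setXI].
- by move=> _; exists setT => //; exists setT => //; rewrite setXTT.
- by rewrite bigcup_const//; exists 0%N.
- by move=> _ [A mA [B mB <-]]; exact: m12.
Qed.

Definition independent_rv d d' (U : measurableType d) (V : measurableType d')
    (Z : Omega -> U) (X : Omega -> V) :=
  forall A B, measurable A -> measurable B ->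
    P (Z @^-1` A `&` X @^-1` B) = P (Z @^-1` A) * P (X @^-1` B).

(** The joint law of independent variables is a product, so that one of them may be
    replaced by a copy on a second factor of the probability space. *)
Lemma independent_fubini (Z : Omega -> S) (X : Omega -> T) (f : S * T -> \bar R) :
  measurable_fun setT Z -> measurable_fun setT X -> independent_rv Z X ->
  measurable_fun setT f -> (forall z, 0 <= f z) ->
  \int[P]_w f (Z w, X w) = \int[P]_w \int[P]_w' f (Z w, X w').
Proof.
move=> mZ mX indep mf f0.
have mZX : measurable_fun setT (fun w => (Z w, X w)) by exact: measurable_fun_pair.
have mid : measurable_fun setT (fun w : Omega * Omega => (Z w.1, X w.2)).
  apply: measurable_fun_pair; first exact: measurableT_comp mZ measurable_fst.
  exact: measurableT_comp mX measurable_snd.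
have := @fubini_tonelli1 _ _ _ _ _ P P (fun w => f (Z w.1, X w.2))
  (measurableT_comp mf mid) (fun _ => f0 _).
rewrite /fubini_F /= => <-.
rewrite -[LHS](@ge0_integral_pushforward _ _ _ _ _ _ mZX P setT f)//.
rewrite -[RHS](@ge0_integral_pushforward _ _ _ _ _ _ mid (P \x P) setT f)//.
apply: eq_measure_integral => A mA _.
apply: measure_unique_rectangles => //.
  by rewrite /= /pushforward preimage_setT probability_setT ltry.
move=> B C mB mC; rewrite /= /pushforward.
rewrite (_ : (fun w => (Z w, X w)) @^-1` (B `*` C) = Z @^-1` B `&` X @^-1` C)//.
rewrite (_ : (fun w => (Z w.1, X w.2)) @^-1` (B `*` C) = (Z @^-1` B) `*` (X @^-1` C))//.
rewrite indep// product_measure1E//; exact: measurable_preimageT.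
Qed.

(** The hypothesis on rectangles says that [P] conditioned on [W] and [P] give the
    same law to the pair [(Z, X)]; rectangles determine a finite measure. *)
Lemma independent_pair_event (Z : Omega -> S) (X : Omega -> T) (W : set Omega) :
  measurable_fun setT Z -> measurable_fun setT X -> measurable W ->
  (forall A B, measurable A -> measurable B ->
    P (Z @^-1` A `&` X @^-1` B `&` W) = P (Z @^-1` A `&` X @^-1` B) * P W) ->
  forall C, measurable C ->
    P ((fun w => (Z w, X w)) @^-1` C `&` W) =
    P ((fun w => (Z w, X w)) @^-1` C) * P W.
Proof.
move=> mZ mX mW indep.
have mZX : measurable_fun setT (fun w => (Z w, X w)) by exact: measurable_fun_pair.
pose m1 : {measure set (S * T) -> \bar R} :=
  pushforward (mrestr P mW) (fun w => (Z w, X w)).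
have PW0 : (0 <= fine (P W))%R by rewrite fine_ge0.
pose m2 : {measure set (S * T) -> \bar R} :=
  mscale (NngNum PW0) (pushforward P (fun w => (Z w, X w))).
have PWE : P W = (fine (P W))%:E by rewrite fineK// fin_num_measure.
move=> C mC.
have -> : P ((fun w => (Z w, X w)) @^-1` C `&` W) = m1 mZX C by [].
rewrite muleC [X in X * _]PWE.
apply: (@measure_unique_rectangles (m1 mZX) (m2 mZX)) => //.
  rewrite /m1 /= /pushforward /mrestr.
  by rewrite preimage_setT setTI -ge0_fin_numE ?fin_num_measure.
move=> A B mA mB.
rewrite /m1 /m2 /= /pushforward /mrestr /mscale/= -PWE muleC.
exact: indep.
Qed.

End independence.

Section independent_chain.
Local Open Scope ereal_scope.
Context d1 d2 d3 (Omega : measurableType d1) (S : measurableType d2)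
  (T : measurableType d3) (R : realType) (P : probability Omega R).
Variables (m : nat) (X : nat -> Omega -> T) (St : nat -> Omega -> S) (s0 : S)
  (F : nat -> S * T -> S).
Hypothesis mX : forall i, measurable_fun setT (X i).
Hypothesis X_indep : mutually_independent P (fun i : 'I_m => X i).
Hypothesis mF : forall i, measurable_fun setT (F i).
Hypothesis St0 : forall w, St 0%N w = s0.
Hypothesis StS : forall i w, St i.+1 w = F i (St i w, X i w).

Lemma measurable_chain i : measurable_fun setT (St i).
Proof.
elim: i => [|i IH].
  by rewrite (_ : St 0%N = cst s0)//; apply/funext => w; rewrite St0.
rewrite (_ : St i.+1 = F i \o (fun w => (St i w, X i w))).
  by apply: measurableT_comp (mF i) _; exact: measurable_fun_pair.
by apply/funext => w; rewrite StS.
Qed.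

Let future i (V : nat -> set T) : set Omega :=
  \bigcap_(k : 'I_m) X k @^-1` (if (i <= k)%N then V k else setT).

Let future_measurable i V : (forall k, measurable (V k)) ->
  measurable (future i V).
Proof.
move=> mV; apply: fin_bigcap_measurable => // k _.
by apply: measurable_preimageT => //; case: ifP.
Qed.

Let future_prod i V : (forall k, measurable (V k)) ->
  P (future i V) =
  \prod_(k < m) P (X k @^-1` (if (i <= k)%N then V k else setT)).
Proof.
move=> mV; rewrite /future.
by apply: (X_indep (V := fun k : 'I_m => if (i <= k)%N then V k else setT)) => k; case: ifP.
Qed.

(** The current state is independent of the whole future of the noise; the
    induction enlarges the past by one variable at the expense of the future. *)
Lemma chain_independent_future i (V : nat -> set T) (E : set S) : (i <= m)%N ->
  (forall k, measurable (V k)) -> measurable E ->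
  P (St i @^-1` E `&` future i V) = P (St i @^-1` E) * P (future i V).
Proof.
elim: i V E => [|i IH] V E im mV mE.
  have [s0E|s0E] := pselect (E s0).
    rewrite (_ : St 0%N @^-1` E = setT) ?setTI ?probability_setT ?mul1e//.
    by apply/seteqP; split => // w _; rewrite /= St0.
  rewrite (_ : St 0%N @^-1` E = set0) ?set0I ?measure0 ?mul0e//.
  by apply/seteqP; split => // w; rewrite /= St0.
pose upd (U : set T) (V : nat -> set T) k := if k == i then U else V k.
have mupd U V' : measurable U -> (forall k, measurable (V' k)) ->
    forall k, measurable (upd U V' k).
  by move=> mU mV' k; rewrite /upd; case: ifP.
have split_future U V' : future i (upd U V') = X i @^-1` U `&` future i.+1 V'.
  apply/seteqP; split => w.
    move=> wf; split; first by have := wf (Ordinal im) I; rewrite /upd /= leqnn eqxx.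
    move=> k _; have := wf k I; rewrite /upd /=.
    by case: ltngtP => // ->; rewrite ltnn.
  move=> [wU wf] k _; have := wf k I; rewrite /upd /=.
  by case: (ltngtP i k) => // ik _; rewrite -ik.
have prod_future U V' : measurable U -> (forall k, measurable (V' k)) ->
    P (future i (upd U V')) = P (X i @^-1` U) * P (future i.+1 V').
  move=> mU mV'; rewrite !future_prod//; last exact: mupd.
  rewrite (bigD1 (Ordinal im))//= [in RHS](bigD1 (Ordinal im))//=.
  rewrite /upd leqnn eqxx ltnn preimage_setT probability_setT mul1e.
  congr (_ * _); apply: eq_bigr => k ki; congr (P (_ @^-1` _)).
  have ki' : (k != i :> nat) by move: ki; rewrite -val_eqE.
  by rewrite leq_eqVlt [i == k]eq_sym (negbTE ki').
have futureT : future i.+1 (fun=> setT) = setT.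
  by apply/seteqP; split => // w _ k _ /=; rewrite if_same.
have indep U E' V' : measurable U -> measurable E' -> (forall k, measurable (V' k)) ->
    P (St i @^-1` E' `&` X i @^-1` U `&` future i.+1 V') =
    P (St i @^-1` E') * P (X i @^-1` U) * P (future i.+1 V').
  move=> mU mE' mV'; rewrite -setIA -split_future IH ?(ltnW im)//; last exact: mupd.
  by rewrite prod_future// muleA.
rewrite (_ : St i.+1 @^-1` E = (fun w => (St i w, X i w)) @^-1` (F i @^-1` E)); last first.
  by apply/seteqP; split => w; rewrite /= StS.
apply: independent_pair_event => //.
- exact: measurable_chain.
- exact: future_measurable.
- move=> A B mA mB; rewrite indep//; congr (_ * _).
  by have := indep B A (fun=> setT) mB mA (fun=> measurableT);
    rewrite futureT setIT probability_setT mule1.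
- exact: measurable_preimageT.
Qed.

Lemma chain_independent i : (i < m)%N -> independent_rv P (St i) (X i).
Proof.
move=> im A B mA mB.
pose V k := if k == i then B else setT.
have mV k : measurable (V k) by rewrite /V; case: ifP.
have := chain_independent_future (ltnW im) mV mA.
suff -> : future i V = X i @^-1` B by [].
apply/seteqP; split => w.
  by move=> /(_ (Ordinal im) I); rewrite /V /= leqnn eqxx.
by move=> wB k _; rewrite /V /=; case: eqP => [->|_]; rewrite ?leqnn ?if_same.
Qed.

End independent_chain.

(** * Euclidean geometry of row vectors *)

Section row_vectors.
Context {R : realType}.

Definition sqnorm d (x : 'rV[R]_d) : R := dotp x x.

Lemma sqnormE d (x : 'rV[R]_d) : sqnorm x = \sum_(i < d) x 0 i ^+ 2.
Proof. by apply: eq_bigr => i _; rewrite expr2. Qed.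

Lemma sqnorm_ge0 d (x : 'rV[R]_d) : 0 <= sqnorm x.
Proof. by rewrite sqnormE sumr_ge0// => i _; rewrite sqr_ge0. Qed.

Lemma enorm_sqr d (x : 'rV[R]_d) : enorm x ^+ 2 = sqnorm x.
Proof.
rewrite /enorm /frobenius big_ord1 sqr_sqrtr ?sqnormE//.
by rewrite sumr_ge0// => i _; rewrite sqr_ge0.
Qed.

Lemma enorm_ge0 d (x : 'rV[R]_d) : 0 <= enorm x.
Proof. exact: sqrtr_ge0. Qed.

Lemma frobenius_sqr m n (M : 'M[R]_(m, n)) :
  frobenius M ^+ 2 = \sum_(i < m) \sum_(j < n) M i j ^+ 2.
Proof.
rewrite /frobenius sqr_sqrtr// sumr_ge0// => i _.
by rewrite sumr_ge0// => j _; rewrite sqr_ge0.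
Qed.

Lemma cauchy_schwarz n (x y : 'I_n -> R) :
  (\sum_i x i * y i) ^+ 2 <= (\sum_i x i ^+ 2) * (\sum_i y i ^+ 2).
Proof.
have : 0 <= \sum_i \sum_j (x i * y j - x j * y i) ^+ 2.
  by rewrite sumr_ge0// => i _; rewrite sumr_ge0// => j _; rewrite sqr_ge0.
suff -> : \sum_i \sum_j (x i * y j - x j * y i) ^+ 2 =
    2 * ((\sum_i x i ^+ 2) * (\sum_i y i ^+ 2) - (\sum_i x i * y i) ^+ 2) by lra.
have E1 : (\sum_i x i ^+ 2) * (\sum_i y i ^+ 2) =
    \sum_i \sum_j x i ^+ 2 * y j ^+ 2.
  by rewrite mulr_suml; apply: eq_bigr => i _; rewrite mulr_sumr.
have E2 : (\sum_i x i ^+ 2) * (\sum_i y i ^+ 2) =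
    \sum_i \sum_j x j ^+ 2 * y i ^+ 2.
  by rewrite mulrC mulr_suml; apply: eq_bigr => i _; rewrite mulr_sumr;
    apply: eq_bigr => j _; rewrite mulrC.
have E3 : (\sum_i x i * y i) ^+ 2 = \sum_i \sum_j (x i * y i) * (x j * y j).
  by rewrite expr2 mulr_suml; apply: eq_bigr => i _; rewrite mulr_sumr.
rewrite mulrBr mulr_natl mulr2n {1}E1 E2 E3 mulr_natl mulr2n -!big_split/= -sumrB.
apply: eq_bigr => i _; rewrite -!big_split/= -sumrB; apply: eq_bigr => j _; ring.
Qed.

Lemma sqnorm_mulmx_le m d (x : 'rV[R]_m) (M : 'M[R]_(m, d)) :
  sqnorm (x *m M) <= frobenius M ^+ 2 * sqnorm x.
Proof.
rewrite frobenius_sqr exchange_big/= sqnormE mulr_suml; apply: ler_sum => j _.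
rewrite mxE mulrC sqnormE; exact: cauchy_schwarz.
Qed.

Lemma frobenius_tr m n (M : 'M[R]_(m, n)) : frobenius M^T = frobenius M.
Proof.
rewrite /frobenius exchange_big/=; congr Num.sqrt.
by apply: eq_bigr => i _; apply: eq_bigr => j _; rewrite mxE.
Qed.

Lemma dotp_mulmx_tr m d (x : 'rV[R]_d) (y : 'rV[R]_m) (M : 'M[R]_(m, d)) :
  dotp x (y *m M) = dotp (x *m M^T) y.
Proof.
rewrite /dotp; under eq_bigr do rewrite mxE mulr_sumr.
rewrite exchange_big/=; apply: eq_bigr => i _.
by rewrite mxE mulr_suml; apply: eq_bigr => j _; rewrite mxE; ring.
Qed.

Lemma sqnormD d (x y : 'rV[R]_d) :
  sqnorm (x + y) = sqnorm x + 2 * dotp x y + sqnorm y.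
Proof.
rewrite /sqnorm /dotp mulr_sumr -!big_split/=.
by apply: eq_bigr => i _; rewrite !mxE; ring.
Qed.

Lemma dotpZr d (c : R) (x y : 'rV[R]_d) : dotp x (c *: y) = c * dotp x y.
Proof. by rewrite /dotp mulr_sumr; apply: eq_bigr => i _; rewrite mxE; ring. Qed.

Lemma dotpZl d (c : R) (x y : 'rV[R]_d) : dotp (c *: x) y = c * dotp x y.
Proof. by rewrite /dotp mulr_sumr; apply: eq_bigr => i _; rewrite mxE; ring. Qed.

Lemma sqnormZ d (c : R) (x : 'rV[R]_d) : sqnorm (c *: x) = c ^+ 2 * sqnorm x.
Proof. by rewrite /sqnorm dotpZl dotpZr mulrA expr2. Qed.

(** A drift of size [dl * al] is paid for by the spare variance [2 * e * dl]. *)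
Lemma sqnorm_drift_le d (y a : 'rV[R]_d) (g e dl al : R) :
  0 <= g -> 0 < e -> 0 <= dl -> sqnorm a <= al ^+ 2 ->
  g / (1 + 2 * e * g * dl) * sqnorm (y + dl *: a) <=
  g * sqnorm y + al ^+ 2 / (2 * e) * dl.
Proof.
move=> g0 e0 dl0 aal; have D0 : 0 < 1 + 2 * e * g * dl.
  by rewrite ltr_pwDl// !mulr_ge0// ltW.
rewrite mulrAC ler_pdivrMr// sqnormD sqnormZ dotpZr.
have young : 2 * g * dotp y a <= 2 * e * g ^+ 2 * sqnorm y + sqnorm a / (2 * e).
  have := sqnorm_ge0 ((2 * e * g) *: y + (- 1) *: a).
  rewrite sqnormD !sqnormZ dotpZl dotpZr sqrrN expr1n mul1r => h.
  rewrite -(ler_pM2r (_ : 0 < 2 * e)) ?mulr_gt0// [leRHS]mulrDl divfK; last first.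
    by rewrite gt_eqF// mulr_gt0.
  by lra.
have h1 := ler_wpM2l dl0 young.
have h2 : sqnorm a / (2 * e) <= al ^+ 2 / (2 * e).
  by rewrite ler_pM2r// invr_gt0 mulr_gt0.
have h3 := ler_wpM2l dl0 h2.
have h4 : g * dl ^+ 2 * sqnorm a <= g * dl ^+ 2 * al ^+ 2.
  by rewrite ler_wpM2l// mulr_ge0// sqr_ge0.
have E : (g * sqnorm y + al ^+ 2 / (2 * e) * dl) * (1 + 2 * e * g * dl) =
  g * sqnorm y + 2 * e * g ^+ 2 * dl * sqnorm y + dl * (al ^+ 2 / (2 * e))
   + g * dl ^+ 2 * al ^+ 2.
  by field; rewrite gt_eqF.
by rewrite E; lra.
Qed.

End row_vectors.

(** * Gaussian steps *)

Section independent_product.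
Local Open Scope ereal_scope.

(** The partial products form a chain driven by the [X i], hence are independent of
    the next factor. *)
Lemma integral_independent_prod_le dO (Omega : measurableType dO) (R : realType)
    (P : probability Omega R) (m : nat) (X : 'I_m -> Omega -> R)
    (g : 'I_m -> R -> R) (c : 'I_m -> R) :
  (forall i, measurable_fun setT (X i)) -> mutually_independent P X ->
  (forall i, measurable_fun setT (g i)) -> (forall i x, 0 <= g i x)%R ->
  (forall i, 0 <= c i)%R ->
  (forall i, \int[P]_w (g i (X i w))%:E <= (c i)%:E) ->
  \int[P]_w (\prod_(i < m) g i (X i w))%:E <= (\prod_(i < m) c i)%:E.
Proof.
move=> mX indep mg g0 c0 gc.
pose X' (k : nat) : Omega -> R := if insub k is Some i then X i else cst 0%R.
pose g' (k : nat) : R -> R := if insub k is Some i then g i else cst 1%R.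
pose c' (k : nat) : R := if insub k is Some i then c i else 1%R.
have X'E (i : 'I_m) : X' i = X i by rewrite /X' valK.
have g'E (i : 'I_m) : g' i = g i by rewrite /g' valK.
have c'E (i : 'I_m) : c' i = c i by rewrite /c' valK.
have mX' k : measurable_fun setT (X' k) by rewrite /X'; case: insub.
have mg' k : measurable_fun setT (g' k) by rewrite /g'; case: insub.
have g'0 k x : (0 <= g' k x)%R by rewrite /g'; case: insub => //= _; exact: ler01.
have c'0 k : (0 <= c' k)%R by rewrite /c'; case: insub => //= _; exact: ler01.
have indep' : mutually_independent P (fun i : 'I_m => X' i).
  by rewrite (_ : (fun i : 'I_m => X' i) = X)//; apply/funext => i; rewrite X'E.
pose St k w : R := (\prod_(i < k) g' i (X' i w))%R.
pose F k (z : R * R) : R := (z.1 * g' k z.2)%R.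
have mF k : measurable_fun setT (F k).
  by apply: measurable_funM => //; exact: measurableT_comp.
have St0 w : St 0%N w = 1%R by rewrite /St big_ord0.
have StS k w : St k.+1 w = F k (St k w, X' k w) by rewrite /St big_ord_recr.
have mSt := measurable_chain mX' mF St0 StS.
have St_ge0 k w : (0 <= St k w)%R by rewrite /St prodr_ge0.
suff H k : (k <= m)%N -> \int[P]_w (St k w)%:E <= (\prod_(i < k) c' i)%:E.
  have := H m (leqnn m).
  under eq_integral => w _.
    by rewrite /St (_ : \prod_(i < m) g' i (X' i w) = \prod_(i < m) g i (X i w))%R;
      [over|apply: eq_bigr => i _; rewrite X'E g'E].
  by under eq_bigr do rewrite c'E.
elim: k => [_|k IH km].
  rewrite big_ord0; under eq_integral do rewrite St0.
  by rewrite integral_probability_cst.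
pose f (z : R * R) : \bar R := (`|z.1| * g' k z.2)%:E.
have mf : measurable_fun setT f.
  apply/measurable_EFinP; apply: measurable_funM.
    by apply: measurableT_comp => //.
  exact: measurableT_comp.
have f0 z : 0 <= f z by rewrite lee_fin mulr_ge0.
have ki := chain_independent mX' indep' mF St0 StS km.
have -> : \int[P]_w (St k.+1 w)%:E = \int[P]_w f (St k w, X' k w).
  by apply: eq_integral => w _; rewrite StS /f /F /= ger0_norm.
rewrite (independent_fubini (mSt k) (mX' k) ki mf f0).
apply: (@le_trans _ _ (\int[P]_w ((c' k)%:E * (St k w)%:E))).
  apply: ge0_le_integral => //.
  - by move=> w _; apply: integral_ge0.
  - have mid : measurable_fun setT (fun z : Omega * Omega => f (St k z.1, X' k z.2)).
      apply: measurableT_comp => //; apply: measurable_fun_pair.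
        exact: measurableT_comp (mSt k) measurable_fst.
      exact: measurableT_comp (mX' k) measurable_snd.
    exact: (measurable_fun_fubini_tonelli_F (m2 := P) _ mid (fun z => f0 _)).
  - apply: emeasurable_funM => //; exact/measurable_EFinP.
  - move=> w _; rewrite /f /=.
    under eq_integral do rewrite EFinM.
    have mgX : measurable_fun setT (fun w => (g' k (X' k w))%:E).
      by apply/measurable_EFinP; exact: measurableT_comp.
    rewrite ge0_integralZl ?lee_fin//; last by move=> y _; rewrite lee_fin.
    rewrite ger0_norm// muleC lee_wpmul2r ?lee_fin//.
    have -> : k = Ordinal km :> nat by [].
    rewrite c'E; under eq_integral do rewrite X'E g'E.
    exact: gc.
rewrite ge0_integralZl ?lee_fin//; first last.
- by move=> y _; rewrite lee_fin.
- exact/measurable_EFinP.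
rewrite big_ord_recr/= [in leRHS]mulrC EFinM.
by rewrite lee_wpmul2l ?lee_fin// IH// ltnW.
Qed.

End independent_product.

Section gaussian_vectors.
Context dO (Omega : measurableType dO) (R : realType) (P : probability Omega R).

(** The law of the increment of a Brownian motion over a time of length [dl]. *)
Definition gaussian_increment d (dl : R) (xi : Omega -> 'rV[R]_d) : Prop :=
  [/\ forall i, measurable_fun setT (fun w => xi w 0 i),
      mutually_independent P (fun (i : 'I_d) w => xi w 0 i) &
      forall (i : 'I_d) (V : set R), measurable V ->
        P ((fun w => xi w 0 i) @^-1` V) = normal_prob 0 (Num.sqrt dl) V].

Lemma gaussian_exp_quadratic d (dl : R) (xi : Omega -> 'rV[R]_d) (c : 'rV[R]_d)
    (g : R) : 0 < dl -> gaussian_increment dl xi -> 0 <= g -> 2 * g * dl < 1 ->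
  (\int[P]_w (expR (dotp c (xi w) + g * sqnorm (xi w)))%:E <=
  ((1 - 2 * g * dl)^-1 ^+ d *
    expR (sqnorm c * dl / (2 * (1 - 2 * g * dl))))%:E)%E.
Proof.
move=> dl0 [mxi indep law] g0 gdl.
pose q := 1 - 2 * g * dl; have q0 : 0 < q by rewrite /q; lra.
pose gf (i : 'I_d) (x : R) := expR (c 0 i * x + g * x ^+ 2).
pose cf (i : 'I_d) := q^-1 * expR (c 0 i ^+ 2 * dl / (2 * q)).
have s0 : 0 < Num.sqrt dl by rewrite sqrtr_gt0.
have mgf i : measurable_fun setT (gf i).
  apply: measurableT_comp => //; apply: measurable_funD.
    exact: measurable_funM.
  by apply: measurable_funM => //; exact: measurable_funX.
have gfc i : (\int[P]_w (gf i (xi w 0 i))%:E <= (cf i)%:E)%E.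
  have := @normal_prob_exp_quadratic R (Num.sqrt dl) (c 0 i) g s0 g0.
  rewrite sqr_sqrtr ?(ltW dl0)// -/q => /(_ gdl); apply: le_trans.
  (* [normal_prob] is a measure on [measurableTypeR R], a type convertible to [R]
     but with its own measurable instance *)
  have mxi' : measurable_fun setT (fun w => xi w 0 i : measurableTypeR R).
    exact: mxi i.
  have mgf' : measurable_fun [set: measurableTypeR R] (fun x => (gf i x)%:E).
    by apply/measurable_EFinP; exact: mgf.
  have := ge0_integral_pushforward mxi' P measurableT mgf'.
  rewrite preimage_setT => /(_ _)/esym -> //; last first.
    by move=> x _; rewrite lee_fin expR_ge0.
  rewrite le_eqVlt; apply/orP; left; apply/eqP.
  by apply: eq_measure_integral => V mV _; exact: law.
have := integral_independent_prod_le mxi indep mgf (fun i x => expR_ge0 _) _ gfc.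
have -> : \prod_(i < d) cf i = q^-1 ^+ d * expR (sqnorm c * dl / (2 * q)).
  rewrite big_split/= prodr_const card_ord -expR_sum; congr (_ * expR _).
  by rewrite sqnormE -2!mulr_suml.
have expE w : \prod_(i < d) gf i (xi w 0 i) = expR (dotp c (xi w) + g * sqnorm (xi w)).
  by rewrite -expR_sum big_split/= -mulr_sumr sqnormE.
under eq_integral do rewrite expE.
by apply=> i; rewrite mulr_ge0 ?expR_ge0// invr_ge0 ltW.
Qed.

(** Shrinking the coefficient [g] as if the noise had covariance [2 eta] more than
    compensates the actual noise, of strength at most [bt < 2 eta]; the spare
    covariance [2 eta - bt] absorbs the drift, uniformly in [y]. *)
Lemma gaussian_step d (dl : R) (xi : Omega -> 'rV[R]_d) (y a : 'rV[R]_d)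
    (M : 'M[R]_d) (g eta bt al : R) :
  0 < dl -> gaussian_increment dl xi -> 0 <= g ->
  0 <= bt -> bt < 2 * eta -> frobenius M ^+ 2 <= bt -> sqnorm a <= al ^+ 2 ->
  (\int[P]_w (expR (g / (1 + 4 * eta * g * dl) *
      sqnorm (y + dl *: a + xi w *m M^T)))%:E <=
  ((1 + 4 * eta * g * dl) ^+ d *
    expR (g * sqnorm y + al ^+ 2 / (2 * (2 * eta - bt)) * dl))%:E)%E.
Proof.
move=> dl0 hxi g0 bt0 bteta Mbt aal.
have [e eE] : exists e, e = 2 * eta - bt by exists (2 * eta - bt).
rewrite -eE; have e0 : 0 < e by rewrite eE; lra.
have etaE : 4 * eta = 2 * (e + bt) by rewrite eE; ring.
have [D DE] : exists D, D = 1 + 4 * eta * g * dl by exists (1 + 4 * eta * g * dl).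
rewrite -DE.
have gdl0 : 0 <= g * dl by rewrite mulr_ge0// ltW.
have D1 : 1 <= D.
  by rewrite DE etaE -mulrA lerDl mulr_ge0//; lra.
have D0 : 0 < D by apply: lt_le_trans D1.
have [E EE] : exists E, E = 1 + 2 * e * g * dl by exists (1 + 2 * e * g * dl).
have E1 : 1 <= E by rewrite EE -mulrA lerDl mulr_ge0//; lra.
have E0 : 0 < E by apply: lt_le_trans E1.
have DEE : D - 2 * g * bt * dl = E by rewrite DE EE etaE; ring.
set w0 := y + dl *: a.
have g'0 : 0 <= g / D by rewrite divr_ge0// ltW.
have qE : 1 - 2 * (g / D * bt) * dl = E / D.
  by rewrite -DEE; field; rewrite gt_eqF.
have bound w : expR (g / D * sqnorm (w0 + xi w *m M^T)) <=
    expR (g / D * sqnorm w0) *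
    expR (dotp ((2 * (g / D)) *: (w0 *m M)) (xi w) + (g / D * bt) * sqnorm (xi w)).
  rewrite -expRD ler_expR sqnormD dotp_mulmx_tr trmxK dotpZl.
  have h : sqnorm (xi w *m M^T) <= bt * sqnorm (xi w).
    apply: le_trans (sqnorm_mulmx_le _ _) _; rewrite frobenius_tr.
    by rewrite ler_wpM2r// sqnorm_ge0.
  by have := ler_wpM2l g'0 h; lra.
have mexp (c : 'rV[R]_d) (k : R) :
    measurable_fun setT (fun w => expR (dotp c (xi w) + k * sqnorm (xi w))).
  case: hxi => mxi _ _.
  apply: measurableT_comp => //; apply: measurable_funD.
    by apply: measurable_sum => i; exact: measurable_funM.
  apply: measurable_funM => //.
  by apply: measurable_sum => i; exact: measurable_funM.
have mxiM : measurable_fun setT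
    (fun w => expR (g / D * sqnorm (w0 + xi w *m M^T))).
  case: hxi => mxi _ _.
  apply: measurableT_comp => //; apply: measurable_funM => //.
  have mi i : measurable_fun setT (fun w => (w0 + xi w *m M^T) 0 i).
    under eq_fun do rewrite !mxE.
    apply: measurable_funD => //; apply: measurable_sum => j.
    exact: measurable_funM.
  by apply: measurable_sum => i; exact: measurable_funM.
apply: (@le_trans _ _ (\int[P]_w ((expR (g / D * sqnorm w0))%:E *
    (expR (dotp ((2 * (g / D)) *: (w0 *m M)) (xi w) +
       (g / D * bt) * sqnorm (xi w)))%:E))%E).
  apply: ge0_le_integral => //.
  - exact/measurable_EFinP.
  - by apply: emeasurable_funM => //; exact/measurable_EFinP.
  - by move=> w _; rewrite -EFinM lee_fin bound.
rewrite ge0_integralZl ?lee_fin ?expR_ge0//; last exact/measurable_EFinP.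
have gq : 2 * (g / D * bt) * dl < 1.
  by rewrite -subr_gt0 qE divr_gt0.
have := gaussian_exp_quadratic ((2 * (g / D)) *: (w0 *m M)) dl0 hxi
  (mulr_ge0 g'0 bt0) gq.
rewrite qE => h.
apply: le_trans.
  by apply: lee_wpmul2l h; rewrite lee_fin expR_ge0.
rewrite -EFinM lee_fin mulrCA -expRD.
apply: ler_pM.
- by rewrite exprn_ge0// invr_ge0 divr_ge0// ltW.
- exact: expR_ge0.
- rewrite lerXn2r ?nnegrE ?invr_ge0 ?divr_ge0 ?(ltW E0) ?(ltW D0)//.
  by rewrite invf_div ler_pdivrMr// ler_peMr// ltW.
rewrite ler_expR sqnormZ.
have hb : sqnorm (w0 *m M) <= bt * sqnorm w0.
  apply: le_trans (sqnorm_mulmx_le _ _) _.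
  by rewrite ler_wpM2r// sqnorm_ge0.
apply: le_trans (sqnorm_drift_le y g0 e0 (ltW dl0) aal).
rewrite -EE -/w0.
have -> : g / E * sqnorm w0 = g / D * sqnorm w0 +
    (2 * (g / D)) ^+ 2 * (bt * sqnorm w0) * dl / (2 * (E / D)).
  have -> : D = E + 2 * g * bt * dl by rewrite -DEE; ring.
  field; rewrite !gt_eqF//.
  by rewrite ltr_pwDl// -mulrA mulr_ge0// ?mulr_ge0// ltW.
rewrite lerD2l; apply: ler_wpM2r.
  by rewrite invr_ge0 mulr_ge0// divr_ge0// ltW.
by apply: ler_wpM2r; rewrite ?(ltW dl0)// ler_wpM2l// sqr_ge0.
Qed.

End gaussian_vectors.

Section mixture_gaussian_step.

(** A noise step advances the mixture's clock by its duration [dl], term by term: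
    with [g = nu * slope * shrink tau], the shrinking of [gaussian_step] turns
    [shrink tau] into [shrink (tau + dl)]. *)
Lemma mixture_gaussian_step dO (Omega : measurableType dO) (R : realType)
    (P : probability Omega R) d N (dl : R) (xi : Omega -> 'rV[R]_d)
    (y a : 'rV[R]_d) (M : 'M[R]_d) (nu eta bt al be tau : R) :
  0 < dl -> gaussian_increment P dl xi -> 0 <= nu -> 1 < be -> 0 <= tau ->
  0 <= bt -> bt < 2 * eta -> frobenius M ^+ 2 <= bt -> sqnorm a <= al ^+ 2 ->
  (\int[P]_w (mixture d (4 * eta * nu) be N (tau + dl)
      (nu * sqnorm (y + dl *: a + xi w *m M^T)))%:E <=
  (expR (al ^+ 2 / (2 * (2 * eta - bt)) * dl) *
     mixture d (4 * eta * nu) be N tau (nu * sqnorm y))%:E)%E.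
Proof.
move=> dl0 hxi nu0 be1 tau0 bt0 bteta Mbt aal.
have th0 : 0 <= 4 * eta * nu by rewrite mulr_ge0// mulr_ge0//; lra.
set K := al ^+ 2 / _.
have mterm k : measurable_fun setT (fun w =>
    mix_term d (4 * eta * nu) be k (tau + dl) (nu * sqnorm (y + dl *: a + xi w *m M^T))).
  case: hxi => mxi _ _.
  do 2 apply: measurable_funM => //.
  apply: measurableT_comp => //; apply: measurable_funM => //.
  apply: measurable_funM => //; apply: measurable_funM => //.
  have mi i : measurable_fun setT (fun w => (y + dl *: a + xi w *m M^T) 0 i).
    under eq_fun do rewrite !mxE.
    apply: measurable_funD => //; apply: measurable_sum => j.
    exact: measurable_funM.
  by apply: measurable_sum => i; exact: measurable_funM.
under eq_integral do rewrite /mixture -sumEFin.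
have tdl0 : 0 <= tau + dl by rewrite addr_ge0// ltW.
rewrite ge0_integral_sum//; last 2 first.
- by move=> k; exact/measurable_EFinP.
- by move=> k w _; rewrite lee_fin ltW// mix_term_gt0.
rewrite /mixture mulr_sumr -sumEFin; apply: lee_sum => k _.
have s0 := slope_ge0 k be1.
have i0 := shrink_gt0 k be1 th0 tau0.
have i'0 := shrink_gt0 k be1 th0 tdl0.
have den := shrink_den k be1 th0 tau0.
have den' := shrink_den k be1 th0 tdl0.
set g := nu * slope be k * shrink (4 * eta * nu) be k tau.
have g0 : 0 <= g by exact: mulr_ge0 (mulr_ge0 nu0 s0) (ltW i0).
have D0 : 0 < 1 + 4 * eta * g * dl.
  rewrite ltr_pwDl// mulr_ge0 ?(ltW dl0)//; apply: mulr_ge0 => //.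
  by apply: mulr_ge0 => //; lra.
have iD : shrink (4 * eta * nu) be k (tau + dl) * (1 + 4 * eta * g * dl) =
    shrink (4 * eta * nu) be k tau.
  rewrite /g /shrink; move: den den'; move: (slope be k) => s den den'.
  by field; rewrite !gt_eqF ?(lt_le_trans ltr01).
have g'E : g / (1 + 4 * eta * g * dl) =
    nu * slope be k * shrink (4 * eta * nu) be k (tau + dl).
  by rewrite {1}/g -iD mulrA mulfK ?gt_eqF.
have step := gaussian_step y dl0 hxi g0 bt0 bteta Mbt aal.
set c := expR (- ((be - 1) * k%:R ^+ 2)) * shrink (4 * eta * nu) be k (tau + dl) ^+ d.
have c0 : 0 <= c by rewrite mulr_ge0 ?expR_ge0// exprn_ge0// ltW.
have termE z : mix_term d (4 * eta * nu) be k (tau + dl) (nu * sqnorm z) =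
    c * expR (g / (1 + 4 * eta * g * dl) * sqnorm z).
  rewrite g'E /mix_term mulrA; congr (_ * expR _); ring.
have mexp : measurable_fun setT (fun w =>
    (expR (g / (1 + 4 * eta * g * dl) * sqnorm (y + dl *: a + xi w *m M^T)))%:E).
  apply/measurable_EFinP; case: hxi => mxi _ _.
  apply: measurableT_comp => //; apply: measurable_funM => //.
  have mi i : measurable_fun setT (fun w => (y + dl *: a + xi w *m M^T) 0 i).
    under eq_fun do rewrite !mxE.
    apply: measurable_funD => //; apply: measurable_sum => j.
    exact: measurable_funM.
  by apply: measurable_sum => i; exact: measurable_funM.
under eq_integral do rewrite termE EFinM.
rewrite ge0_integralZl ?lee_fin//.
apply: le_trans; first by apply: lee_wpmul2l step; rewrite lee_fin.
rewrite -EFinM lee_fin le_eqVlt; apply/orP; left; apply/eqP.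
rewrite /mix_term -iD exprMn -/K /c.
rewrite (_ : slope be k * (nu * sqnorm y) * _ = g * sqnorm y); last first.
  by rewrite iD /g; ring.
by rewrite expRD; ring.
Qed.

End mixture_gaussian_step.

(** * The flow *)

Section curves.
Context {R : realType} {d : nat}.
Implicit Types (f g : R -> 'rV[R]_d) (v : 'rV[R]_d).

Lemma is_derive_coord f v (u : R) (i : 'I_d) :
  is_derive u 1 f v -> is_derive u 1 (fun s => f s 0 i) (v 0 i).
Proof.
move=> df; have fu : derivable f u 1 by apply: ex_derive.
have fi : derivable (fun s => f s 0 i) u 1.
  exact: ((@derivable_mxP R R^o 1 d f u 1).1 fu 0 i).
apply: DeriveDef => //.
have := derive_mx fu; rewrite (@derive_val _ _ _ _ _ _ _ df) => ->.
by rewrite mxE.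
Qed.

Lemma is_derive_sqnorm f v (u : R) : is_derive u 1 f v ->
  is_derive u 1 (fun s => sqnorm (f s)) (2 * dotp v (f u)).
Proof.
move=> df.
rewrite (_ : (fun s => _) = \sum_(i < d) (fun s => f s 0 i * f s 0 i)); last first.
  by apply/funext => s; rewrite fct_sumE.
rewrite /dotp mulr_sumr; apply: is_derive_sum => i.
have di := is_derive_coord i df.
rewrite (_ : (fun s => _) = (fun s => f s 0 i) * (fun s => f s 0 i))//.
apply: (is_derive_eq (is_deriveM di di)).
by rewrite /GRing.scale/=; ring.
Qed.

Lemma cvg_sqnorm T (F : set_system T) {FF : Filter F} (f : T -> 'rV[R]_d)
    (v : 'rV[R]_d) : f x @[x --> F] --> v -> sqnorm (f x) @[x --> F] --> sqnorm v.
Proof.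
move=> fv; apply: cvg_sum_ord => i.
have fi : f x 0 i @[x --> F] --> v 0 i.
  exact: (continuous_cvg _ (@coord_continuous _ _ _ 0 i v) fv).
by apply: cvgM.
Qed.

Lemma cvg_rV T (F : set_system T) {FF : Filter F} (f : T -> 'rV[R]_d)
    (v : 'rV[R]_d) : (forall i, f x 0 i @[x --> F] --> v 0 i) ->
  f x @[x --> F] --> v.
Proof.
move=> fi; apply/cvg_ballP => e e0.
have : \forall x \near F, forall i, ball (v 0 i) e (f x 0 i).
  by apply: filter_forall => i; have /cvg_ballP := fi i; exact.
by apply: filterS => x fx; split => // k i; rewrite (ord1 k).
Qed.

Lemma sqnorm_cvg0 T (F : set_system T) {FF : Filter F} (f : T -> 'rV[R]_d)
    (v : 'rV[R]_d) : sqnorm (f x - v) @[x --> F] --> 0 -> f x @[x --> F] --> v.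
Proof.
move=> h; apply: cvg_rV => i; apply/cvgrPdist_lt => e e0.
have e2 : 0 < e ^+ 2 by rewrite exprn_gt0.
move/cvgrPdist_lt : h => /(_ _ e2); apply: filterS => x.
rewrite sub0r normrN ger0_norm ?sqnorm_ge0// => hx.
rewrite distrC -(@ltr_pXn2r _ 2)// ?nnegrE ?(ltW e0)//.
apply: le_lt_trans hx; rewrite real_normK ?num_real//.
rewrite sqnormE (bigD1 i)//= !mxE lerDl sumr_ge0// => j _; exact: sqr_ge0.
Qed.

End curves.

Section flow.
Context {R : realType} {d : nat}.
Variables (A : 'rV[R]_d -> 'rV[R]_d) (Phi : R -> 'rV[R]_d -> 'rV[R]_d).
Hypothesis hPhi : is_flow A Phi.

Lemma flow0 x : Phi 0 x = x. Proof. by have [] := hPhi x. Qed.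

Lemma flow_derive x (u : R) : 0 < u ->
  is_derive u 1 (fun s => Phi s x) (A (Phi u x)).
Proof. by move=> u0; have [_ _] := hPhi x; apply. Qed.

Lemma flow_right_continuous x : Phi u x @[u --> 0^'+] --> Phi 0 x.
Proof.
have [_ h _] := hPhi x.
have h0 : u *: (u^-1 *: (Phi u x - Phi 0 x)) @[u --> 0^'+] --> 0 *: A (Phi 0 x).
  apply: cvgZ h.
  by apply: cvg_at_right_filter; exact: cvg_id.
rewrite scale0r in h0.
have h1 : Phi u x - Phi 0 x @[u --> 0^'+] --> (0 : 'rV[R]_d).
  apply: cvg_trans h0; apply: near_eq_cvg; near=> u.
  have u0 : 0 < u by near: u; exact: nbhs_right_gt.
  by rewrite /= scalerA divff ?gt_eqF// scale1r.
rewrite (_ : Phi^~ x = fun u => (Phi u x - Phi 0 x) + Phi 0 x); last first.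
  by apply/funext => u; rewrite subrK.
by rewrite -[X in _ --> X]add0r; apply: cvgD h1 _; exact: cvg_cst.
Unshelve. all: by end_near. Qed.

(** One-sided Lipschitz continuity of the vector field bounds the growth of
    [|Phi s x - Phi s y|^2] by Gronwall's lemma. *)
Lemma flow_lipschitz (L s : R) x y :
  (forall x y, dotp (A x - A y) (x - y) <= L * enorm (x - y) ^+ 2) -> 0 <= s ->
  sqnorm (Phi s x - Phi s y) <= expR (2 * L * s) * sqnorm (x - y).
Proof.
move=> mono s0.
have := @gronwall R (fun u => sqnorm (Phi u x - Phi u y))
  (fun u => 2 * dotp (A (Phi u x) - A (Phi u y)) (Phi u x - Phi u y)) (2 * L) s s0.
rewrite !flow0; apply => //.
- apply: cvg_sqnorm; rewrite -{2}(flow0 x) -{2}(flow0 y).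
  by apply: cvgB; exact: flow_right_continuous.
- move=> u /andP[u0 _]; apply: is_derive_sqnorm.
  exact: is_deriveB (flow_derive x u0) (flow_derive y u0).
- move=> u _; rewrite -mulrA ler_pM2l// -enorm_sqr; exact: mono.
Qed.

End flow.

Section lyapunov_function.
Context {R : realType}.

(** The scale [nu] turns [nu |y|^2], raised to the power [be = (1 + kappa) / 2],
    into the exponent of the theorem. *)
Lemma scaled_sqnorm_powR d (lambda kappa : R) (y : 'rV[R]_d) :
  0 < lambda -> 1 < kappa ->
  ((lambda / (1 + kappa)) `^ (2 / (1 + kappa)) * sqnorm y) `^ ((1 + kappa) / 2) =
  lambda / (1 + kappa) * enorm y `^ (1 + kappa).
Proof.
move=> l0 k1.
rewrite powRM ?powR_ge0 ?sqnorm_ge0// -powRrM.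
rewrite (_ : 2 / (1 + kappa) * ((1 + kappa) / 2) = 1); last by field; lra.
rewrite powRr1; last by rewrite divr_ge0//; lra.
congr (_ * _); rewrite -enorm_sqr -(@powR_mulrn _ _ 2) ?enorm_ge0// -powRrM.
by congr (_ `^ _); field.
Qed.

(** The flow turns the mixture's clock back by its duration. By dissipativity
    [t = nu |Phi|^2] satisfies the inequality of [mixture_along] with
    [om = Cdiss / (eta * lambda)], which exceeds 1 because [lambda] is subcritical. *)
Lemma flow_mixture d (A : 'rV[R]_d -> 'rV[R]_d) (Phi : R -> 'rV[R]_d -> 'rV[R]_d)
    (kappa Cdiss C_2 lambda eta nu be : R) :
  1 < kappa -> 0 < C_2 -> 0 < lambda -> 0 < eta -> eta * lambda < Cdiss ->
  (forall x, dotp (A x) x <= - Cdiss * enorm x `^ (1 + kappa) + C_2) ->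
  is_flow A Phi ->
  be = (1 + kappa) / 2 -> nu = (lambda / (1 + kappa)) `^ (2 / (1 + kappa)) ->
  exists2 K : R, 0 <= K & forall N (s : R) (y : 'rV[R]_d), 0 <= s ->
    mixture d (4 * eta * nu) be N 0 (nu * sqnorm (Phi s y)) <=
    expR (K * s) * mixture d (4 * eta * nu) be N s (nu * sqnorm y).
Proof.
move=> k1 C20 l0 eta0 etal diss hPhi beE nuE.
have be1 : 1 < be by rewrite beE; lra.
have nu0 : 0 <= nu by rewrite nuE powR_ge0.
have om1 : 1 < Cdiss / (eta * lambda) by rewrite ltr_pdivlMr ?mul1r// mulr_gt0.
have Dc0 : 0 <= C_2 / (2 * eta) by rewrite divr_ge0 ?mulr_ge0// ltW.
have th0 : 0 <= 4 * eta * nu by rewrite mulr_ge0// mulr_ge0// ltW.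
have [K K0 HK] := mixture_along d be1 om1 Dc0 th0.
exists K => // N s y s0; rewrite -{2}(flow0 hPhi y).
apply: (HK N s (fun u => nu * sqnorm (Phi u y))
  (fun u => nu * (2 * dotp (A (Phi u y)) (Phi u y))) s0).
- by move=> u _; rewrite mulr_ge0// sqnorm_ge0.
- apply: cvgM; first exact: cvg_cst.
  by apply: cvg_sqnorm; exact: (flow_right_continuous hPhi).
- move=> u /andP[u0 _].
  exact: (is_deriveZ nu (is_derive_sqnorm (flow_derive hPhi y u0))).
- move=> u _.
  have -> : (nu * sqnorm (Phi u y)) `^ be =
      lambda / (1 + kappa) * enorm (Phi u y) `^ (1 + kappa).
    by rewrite nuE beE scaled_sqnorm_powR.
  have h := ler_wpM2l nu0 (diss (Phi u y)).
  apply: (@le_trans _ _ (2 * (nu * (- Cdiss * enorm (Phi u y) `^ (1 + kappa) + C_2)))).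
    by lra.
  rewrite le_eqVlt; apply/orP; left; apply/eqP.
  rewrite beE; field; rewrite !gt_eqF//; lra.
Qed.

End lyapunov_function.

(** * Borel measurability on row vectors *)

Section borel_row_vectors.
Context {R : realType}.

Lemma bigcup_countType_measurable dT (T : measurableType dT) (I : countType)
    (E : I -> set T) : (forall i, measurable (E i)) -> measurable (\bigcup_i E i).
Proof.
move=> mE.
rewrite (_ : \bigcup_i E i =
    \bigcup_(n : nat) (if unpickle n is Some i then E i else set0)).
  by apply: bigcupT_measurable => n; case: unpickle.
apply/seteqP; split => w.
  by move=> [i _ Ew]; exists (pickle i) => //; rewrite pickleK.
by move=> [n _]; case: unpickle => // i Ew; exists i.
Qed.

(** A row vector is random as soon as its coordinates are: an open set is a
    countable union of rational boxes. *)
Lemma measurable_fun_borel_rV d dT (T : measurableType dT) (f : T -> 'rV[R]_d) :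
  (forall i, measurable_fun setT (fun w => f w 0 i)) ->
  measurable_fun setT (f : T -> borel_rV R d).
Proof.
move=> mf; apply: (@measurability _ _ _ (borel_rV R d) _ _ (@open 'rV[R]_d)) => //.
move=> _ [U oU <-]; rewrite setTI.
pose box (p : 'rV[rat]_d * nat) : set T :=
  \bigcap_i [set w | `|f w 0 i - ratr (p.1 0 i)| < (p.2.+1%:R)^-1].
pose inU (p : 'rV[rat]_d * nat) : Prop :=
  forall v : 'rV[R]_d, (forall i, `|v 0 i - ratr (p.1 0 i)| < (p.2.+1%:R)^-1) -> U v.
rewrite (_ : f @^-1` U = \bigcup_p (if pselect (inU p) then box p else set0)).
  apply: bigcup_countType_measurable => p; case: pselect => pU /=; last exact: measurable0.
  apply: fin_bigcap_measurable => // i _.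
  have mg : measurable_fun setT (fun w => `|f w 0 i - ratr (p.1 0 i)|).
    by apply: measurableT_comp => //; apply: measurable_funB.
  rewrite -[X in measurable X]setTI (_ : [set _ | _] =
      (fun w => `|f w 0 i - ratr (p.1 0 i)|) @^-1` `]-oo, (p.2.+1%:R)^-1[).
    by apply: mg.
  by apply/seteqP; split => w; rewrite /= in_itv.
apply/seteqP; split => w; last first.
  by move=> [p _]; case: pselect => pU /= wp; [apply: (pU (f w)) => i; exact: wp|].
move=> /= Uw.
have /nbhs_ballP[e /= e0 eU] : nbhs (f w) U by apply: open_nbhs_nbhs.
have [n ne] : exists n : nat, (n.+1%:R : R)^-1 < e / 2.
  have /cvgrPdist_lt/(_ _ (divr_gt0 e0 (ltr0Sn _ 1))) := @cvg_harmonic R.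
  by case=> N _ /(_ N (leqnn N)); rewrite sub0r normrN ger0_norm ?harmonic_ge0// => h; exists N.
have rat_near (i : 'I_d) : exists q : rat, `|f w 0 i - ratr q| < (n.+1%:R)^-1.
  have n0 : 0 < (n.+1%:R : R)^-1 by rewrite invr_gt0.
  have : f w 0 i - (n.+1%:R)^-1 < f w 0 i + (n.+1%:R)^-1.
    by rewrite ltrD2l gtrN.
  move=> /rat_in_itvoo[q]; rewrite in_itv/= => /andP[q1 q2]; exists q.
  by rewrite ltr_distlC q1 q2.
pose q : 'rV[rat]_d := \row_i sval (cid (rat_near i)).
have qw i : `|f w 0 i - ratr (q 0 i)| < (n.+1%:R)^-1.
  by rewrite mxE; exact: svalP (cid (rat_near i)).
have boxw : box (q, n) w by move=> i _; exact: qw.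
have qU : inU (q, n).
  move=> v vq; apply: eU; split => // k i; rewrite (ord1 k) /ball/=.
  rewrite (_ : f w 0 i - v 0 i =
     (f w 0 i - ratr (q 0 i)) - (v 0 i - ratr (q 0 i))); last by ring.
  apply: le_lt_trans (ler_normB _ _) _.
  by rewrite [e]splitr; apply: ltrD; apply: lt_trans ne; [exact: qw|exact: vq].
by exists (q, n) => //; case: pselect => a /=; [exact: boxw|exact: a qU].
Qed.

Lemma continuous_measurable_borel_rV d (g : 'rV[R]_d -> R) : continuous g ->
  measurable_fun [set: borel_rV R d] g.
Proof.
move=> /continuousP cg.
apply: (@measurability _ _ (borel_rV R d) R _ _ (@RGenOpens.G R));
  first exact: RGenOpens.measurableE.
move=> _ [_ [a [b ->]] <-]; rewrite setTI.
by apply: sub_sigma_algebra; apply: cg; exact: interval_open.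
Qed.

Lemma measurable_coord d i : measurable_fun [set: borel_rV R d]
  (fun y : borel_rV R d => (y : 'rV[R]_d) 0 i).
Proof. by apply: continuous_measurable_borel_rV; exact: coord_continuous. Qed.

Lemma continuous_measurable_borel_rV2 d d' (g : 'rV[R]_d -> 'rV[R]_d') :
  continuous g ->
  measurable_fun [set: borel_rV R d] (g : borel_rV R d -> borel_rV R d').
Proof.
move=> cg; apply: measurable_fun_borel_rV => i.
apply: continuous_measurable_borel_rV => y.
exact: (continuous_comp (cg y) (@coord_continuous _ _ _ 0 i (g y))).
Qed.

End borel_row_vectors.

(** * A maximal inequality *)

Section maximal_inequality.

Fixpoint running_max (R : realType) (u : nat -> R) (n : nat) : R :=
  if n is n'.+1 then Num.max (running_max u n') (u n) else u 0%N.

Lemma le_running_max (R : realType) (u : nat -> R) i n : (i <= n)%N ->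
  u i <= running_max u n.
Proof.
elim: n => [|n IH]; first by rewrite leqn0 => /eqP->.
rewrite leq_eqVlt => /predU1P[->|]; first by rewrite /= le_max lexx orbT.
by rewrite ltnS => /IH h; rewrite /= le_max h.
Qed.

(** Replacing a running maximum [r] by [max r v] in
    [r `^ p + p / (1 - p) * v * r `^ (p - 1)] does not increase it: for
    [v > r] this is Bernoulli's inequality for the power [p] of [v / r]. *)
Lemma running_max_potential (R : realType) (p r v : R) :
  0 < p < 1 -> 0 < r -> 0 < v ->
  Num.max r v `^ p + p / (1 - p) * v * Num.max r v `^ (p - 1) <=
  r `^ p + p / (1 - p) * v * r `^ (p - 1).
Proof.
move=> /andP[p0 p1] r0 v0; have [//|vr] := leP v r.
have q0 : 0 < 1 - p by lra.
have powB1 (z : R) : 0 < z -> z * z `^ (p - 1) = z `^ p.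
  by move=> z0; rewrite mulr_powRB1// ltW.
have vr0 : 0 < v / r by rewrite divr_gt0.
have p01 : 0 <= p <= 1 by lra.
have h := powR_le_bernoulli vr0 p01.
rewrite -mulrA powB1//.
have vp : v `^ p = r `^ p * (v / r) `^ p.
  by rewrite -powRM ?ltW// [r * _]mulrC divfK// gt_eqF.
have vr1 : r `^ p * (v / r) = v * r `^ (p - 1).
  by rewrite -powB1//; field; rewrite gt_eqF.
have h2 := ler_wpM2l (powR_ge0 r p) h; rewrite -vp in h2.
have h3 : r `^ p * (1 + p * (v / r - 1)) =
    (1 - p) * (r `^ p + p / (1 - p) * v * r `^ (p - 1)).
  have -> : r `^ p * (1 + p * (v / r - 1)) =
     (1 - p) * r `^ p + p * (r `^ p * (v / r)) by ring.
  by rewrite vr1; field; rewrite gt_eqF.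
rewrite h3 in h2.
have -> : v `^ p + p / (1 - p) * v `^ p = (1 - p)^-1 * v `^ p.
  by field; rewrite gt_eqF.
by rewrite ler_pdivrMl.
Qed.

Local Open Scope ereal_scope.

(** With the running maximum [r] adjoined to the state, the potential of
    [running_max_potential] is again a supermartingale: replacing [r] by [max r v]
    does not increase it, and for fixed [r] it is affine in the value [v] with a
    nonnegative slope. At time [0] it equals [(1 - p)^-1 * v `^ p], and at the end
    it exceeds [r `^ p]. *)
Lemma chain_maximal_le dO dS dT (Omega : measurableType dO)
    (S : measurableType dS) (T : measurableType dT) (R : realType)
    (P : probability Omega R) (m : nat) (X : nat -> Omega -> T)
    (St : nat -> Omega -> S) (s0 : S) (F : nat -> S * T -> S) (G : nat -> S -> R)
    (p : R) :
  (forall i, measurable_fun setT (X i)) ->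
  mutually_independent P (fun i : 'I_m => X i) ->
  (forall i, measurable_fun setT (F i)) ->
  (forall w, St 0%N w = s0) -> (forall i w, St i.+1 w = F i (St i w, X i w)) ->
  (forall i, measurable_fun setT (G i)) -> (forall i s, 0 < G i s)%R ->
  (forall i s, (i < m)%N -> \int[P]_w (G i.+1 (F i (s, X i w)))%:E <= (G i s)%:E) ->
  (0 < p < 1)%R ->
  measurable_fun setT (fun w => running_max (fun i => G i (St i w)) m) /\
  \int[P]_w (running_max (fun i => G i (St i w)) m `^ p)%:E <=
    ((1 - p)^-1 * G 0%N s0 `^ p)%:E.
Proof.
move=> mX indep mF St0 StS mG G0 super p01.
have /andP[p0 p1] := p01.
have c0 : (0 <= p / (1 - p))%R.
  by apply: divr_ge0; [exact: ltW|rewrite subr_ge0 ltW].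
pose rm i w := running_max (fun i => G i (St i w)) i.
have rm0 i w : (0 < rm i w)%R.
  by elim: i => [|i IH]; rewrite /rm /= ?G0// lt_max IH.
pose St' i w : S * R := (St i w, rm i w).
pose F' i (z : (S * R) * T) : S * R :=
  (F i (z.1.1, z.2), Num.max z.1.2 (G i.+1 (F i (z.1.1, z.2)))).
have mFz i : measurable_fun setT (fun z : (S * R) * T => F i (z.1.1, z.2)).
  apply: measurableT_comp (mF i) _; apply: measurable_fun_pair => //.
  exact: measurableT_comp measurable_fst measurable_fst.
have mF' i : measurable_fun setT (F' i).
  apply: measurable_fun_pair => //; apply: measurable_funTS.
  apply: measurable_maxr.
    exact: measurableT_comp measurable_snd measurable_fst.
  exact: measurableT_comp (mG i.+1) (mFz i).
have St'0 w : St' 0%N w = (s0, G 0%N s0) by rewrite /St' /rm /= St0.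
have St'S i w : St' i.+1 w = F' i (St' i w, X i w) by rewrite /St' /F' /rm /= StS.
have mSt' := measurable_chain mX mF' St'0 St'S.
have mrm i : measurable_fun setT (rm i) by exact: measurableT_comp measurable_snd (mSt' i).
have mSt i : measurable_fun setT (St i) by exact: measurableT_comp measurable_fst (mSt' i).
split; first exact: mrm.
pose pot i (z : S * R) : R := (z.2 `^ p + p / (1 - p) * G i z.1 * z.2 `^ (p - 1))%R.
have mpow (e : R) : measurable_fun setT (fun z : S * R => (z.2 `^ e)%R).
  exact: (measurableT_comp (measurable_powR e) measurable_snd).
have mpot i : measurable_fun setT (pot i).
  apply: measurable_funD => //; apply: measurable_funM => //.
  apply: measurable_funM => //; exact: measurableT_comp (mG i) measurable_fst.
have pot0 i z : (0 <= pot i z)%R.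
  by rewrite addr_ge0 ?powR_ge0// mulr_ge0 ?powR_ge0// mulr_ge0// ltW.
suff pot_le i : (i <= m)%N -> \int[P]_w (pot i (St' i w))%:E <=
    ((1 - p)^-1 * G 0%N s0 `^ p)%:E.
  apply: le_trans (pot_le m (leqnn m)).
  apply: ge0_le_integral => //.
  - by move=> w _; rewrite lee_fin powR_ge0.
  - apply/measurable_EFinP.
    exact: (measurableT_comp (measurable_powR p) (mrm m)).
  - by apply/measurable_EFinP; exact: measurableT_comp (mpot m) (mSt' m).
  - move=> w _; rewrite lee_fin /pot lerDl mulr_ge0 ?powR_ge0//.
    by rewrite mulr_ge0// ltW.
elim: i => [_|i IH im].
  under eq_integral do rewrite St'0.
  rewrite integral_probability_cst lee_fin /pot/= -mulrA.
  rewrite (mulr_powRB1 (ltW (G0 _ _)) p0).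
  rewrite le_eqVlt; apply/orP; left; apply/eqP.
  by field; rewrite gt_eqF// subr_gt0.
pose f (z : (S * R) * T) : \bar R :=
  (z.1.2 `^ p + p / (1 - p) * G i.+1 (F i (z.1.1, z.2)) * z.1.2 `^ (p - 1))%:E.
have mG' : measurable_fun setT (fun z : (S * R) * T => G i.+1 (F i (z.1.1, z.2))).
  exact: measurableT_comp (mG i.+1) (mFz i).
have mf : measurable_fun setT f.
  apply/measurable_EFinP; apply: measurable_funD.
    exact: measurableT_comp (mpow p) measurable_fst.
  apply: measurable_funM; last exact: measurableT_comp (mpow (p - 1)%R) measurable_fst.
  exact: measurable_funM.
have f0 z : 0 <= f z.
  rewrite lee_fin addr_ge0 ?powR_ge0// mulr_ge0 ?powR_ge0// mulr_ge0// ltW//.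
have ind := chain_independent mX indep mF' St'0 St'S im.
have mfX : measurable_fun setT (fun w => f (St' i w, X i w)).
  by apply: measurableT_comp => //; exact: measurable_fun_pair.
apply: (@le_trans _ _ (\int[P]_w f (St' i w, X i w))).
  apply: ge0_le_integral => //.
  - by move=> w _; rewrite lee_fin.
  - by apply/measurable_EFinP; exact: measurableT_comp (mpot _) (mSt' _).
  - move=> w _; rewrite St'S /f /pot /F' /= lee_fin.
    exact: running_max_potential.
rewrite (independent_fubini (mSt' i) (mX i) ind mf f0).
apply: le_trans (IH (ltnW im)).
have mid : measurable_fun setT (fun z : Omega * Omega => f (St' i z.1, X i z.2)).
  apply: measurableT_comp => //; apply: measurable_fun_pair.
    exact: measurableT_comp (mSt' i) measurable_fst.
  exact: measurableT_comp (mX i) measurable_snd.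
apply: ge0_le_integral => //.
- by move=> w _; exact: integral_ge0.
- exact: (measurable_fun_fubini_tonelli_F (m2 := P) _ mid (fun z => f0 _)).
- by apply/measurable_EFinP; exact: measurableT_comp (mpot i) (mSt' i).
- move=> w _; rewrite /f /pot /=.
  have mGX : measurable_fun setT (fun w' => G i.+1 (F i (St i w, X i w'))).
    apply: measurableT_comp (mG i.+1) _; apply: measurableT_comp (mF i) _.
    exact: measurable_fun_pair.
  pose cw := (p / (1 - p) * rm i w `^ (p - 1))%R.
  have cw0 : (0 <= cw)%R by rewrite mulr_ge0// powR_ge0.
  under eq_integral => w' _.
    rewrite (_ : (p / (1 - p) * _ * _ = cw * G i.+1 (F i (St i w, X i w')))%R);
      last by rewrite /cw mulrAC.
    rewrite EFinD EFinM.
    over.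
  rewrite ge0_integralD//; last 3 first.
  - by move=> w' _; rewrite lee_fin powR_ge0.
  - by move=> w' _; rewrite -EFinM lee_fin mulr_ge0// ltW.
  - by apply: emeasurable_funM => //; exact/measurable_EFinP.
  rewrite integral_probability_cst ge0_integralZl ?lee_fin//; first last.
  - by move=> w' _; rewrite lee_fin ltW.
  - exact/measurable_EFinP.
  rewrite EFinD; apply: leeD => //.
  rewrite (_ : (p / (1 - p) * _ * _ = cw * G i (St i w))%R);
    last by rewrite /cw mulrAC.
  by rewrite (EFinM cw) lee_wpmul2l ?lee_fin//; exact: super.
Qed.

End maximal_inequality.

(** * The scheme on a refined grid *)

Section refined_scheme.
Variables (R : realType) (d : nat) (Phi : R -> 'rV[R]_d -> 'rV[R]_d).
Variables (a : 'rV[R]_d -> 'rV[R]_d) (b : 'rV[R]_d -> 'M[R]_d).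
Variables (h : R) (x : 'rV[R]_d) (M : nat).
Hypothesis M0 : (0 < M)%N.

Let dl : R := h / M%:R.

(** The grid that splits each step of length [h] into [M] parts. *)
Definition fine_time (i : nat) : R := i%:R * dl.
Definition fine_elapsed (i : nat) : R := (i %% M)%:R * dl.

(** The state that makes the refined scheme a chain: the value at the last node,
    where the coefficients are frozen, and the current value before the flow is
    applied. At a node the latter restarts from the former. *)
Definition fine_state (B : R -> 'rV[R]_d) (i : nat) : 'rV[R]_d * 'rV[R]_d :=
  let k := (i %/ M)%N in
  let z := splitting_node Phi a b h x B k in
  (z, z + fine_elapsed i *: a z + (B (fine_time i) - B (k%:R * h)) *m (b z)^T).

Definition fine_update (i : nat) (s : ('rV[R]_d * 'rV[R]_d) * 'rV[R]_d) :=
  let y := s.1.2 + dl *: a s.1.1 + s.2 *m (b s.1.1)^T in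
  if (M %| i.+1)%N then (Phi h y, Phi h y) else (s.1.1, y).

Let Mn0 : (M%:R : R) != 0. Proof. by rewrite pnatr_eq0 -lt0n. Qed.

Let Mdl : M%:R * dl = h. Proof. by rewrite /dl mulrC divfK. Qed.

Lemma fine_time_node k : fine_time (k * M) = k%:R * h.
Proof. by rewrite /fine_time natrM -mulrA Mdl. Qed.

Lemma fine_timeE i : fine_time i = (i %/ M)%:R * h + fine_elapsed i.
Proof.
by rewrite -fine_time_node /fine_time /fine_elapsed -mulrDl -natrD -divn_eq.
Qed.

Lemma fine_timeS i : fine_time i.+1 = fine_time i + dl.
Proof. by rewrite /fine_time -natr1 mulrDl mul1r. Qed.

Lemma fine_elapsedS i :
  fine_elapsed i.+1 = if (M %| i.+1)%N then 0 else fine_elapsed i + dl.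
Proof.
rewrite /fine_elapsed modnS; case: ifP => _; first by rewrite mul0r.
by rewrite -natr1 mulrDl mul1r.
Qed.

Lemma fine_elapsed_node i : (M %| i.+1)%N -> fine_elapsed i + dl = h.
Proof.
move=> Mi; rewrite /fine_elapsed -[X in _ + X]mul1r -mulrDl natr1 -[RHS]Mdl.
congr (_%:R * _); apply/eqP; rewrite -(eqn_add2l (i %/ M * M)) addnS -divn_eq.
by rewrite -{1}(divnK Mi) divnS// Mi add1n mulSnr.
Qed.

Lemma fine_state0 B : fine_state B 0 = (x, x).
Proof.
rewrite /fine_state div0n /fine_elapsed mod0n /fine_time !mul0r /= scale0r addr0.
by rewrite subrr mul0mx addr0.
Qed.

Let fine_state_y B i :
  (fine_state B i).2 + dl *: a (fine_state B i).1 +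
    (B (fine_time i.+1) - B (fine_time i)) *m (b (fine_state B i).1)^T =
  let z := (fine_state B i).1 in
  z + (fine_elapsed i + dl) *: a z +
    (B (fine_time i.+1) - B ((i %/ M)%:R * h)) *m (b z)^T.
Proof.
rewrite /fine_state /=; set z := splitting_node _ _ _ _ _ _ _.
set c := (i %/ M)%:R * h.
have -> : (B (fine_time i.+1) - B c) *m (b z)^T =
    (B (fine_time i) - B c) *m (b z)^T +
    (B (fine_time i.+1) - B (fine_time i)) *m (b z)^T.
  by rewrite -mulmxDl [in RHS]addrC subrKA.
by rewrite scalerDl !addrA; congr (_ + _); rewrite [in RHS]addrAC.
Qed.

Lemma fine_stateS B i : fine_state B i.+1 =
  fine_update i (fine_state B i, B (fine_time i.+1) - B (fine_time i)).
Proof.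
rewrite /fine_update [in RHS]fine_state_y /= {1}/fine_state divnS//.
have [Mi|Mi] := boolP (M %| i.+1)%N; last first.
  by rewrite add0n fine_elapsedS (negbTE Mi).
rewrite fine_elapsedS Mi add1n scale0r addr0.
have -> : fine_time i.+1 = (i %/ M).+1%:R * h.
  by rewrite fine_timeE divnS// Mi fine_elapsedS Mi addr0.
rewrite subrr mul0mx addr0 /= /splitting_step.
rewrite -mulrBl -natrB// subSnn mul1r.
by rewrite fine_elapsed_node.
Qed.

(** The refined scheme follows the splitting scheme within each step, both end
    points included. *)
Lemma fine_state_splitting B (k i : nat) : (forall y, Phi 0 y = y) ->
  (k * M <= i <= k.+1 * M)%N ->
  splitting_step Phi a b B (splitting_node Phi a b h x B k) (k%:R * h) (fine_time i) =
  Phi (fine_elapsed i) (fine_state B i).2.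
Proof.
move=> Phi0 /andP[ki ik].
have [->|kn] := eqVneq i (k.+1 * M)%N.
  rewrite fine_time_node /fine_state mulnK// /fine_elapsed modnMl mul0r Phi0.
  rewrite scale0r addr0 fine_time_node subrr mul0mx addr0 /=.
  by [].
have {}ik : (i < k.+1 * M)%N by rewrite ltn_neqAle kn.
have iM : (i %/ M = k)%N.
  by apply/eqP; rewrite eqn_leq -ltnS ltn_divLR// ik leq_divRL.
by rewrite /splitting_step /fine_state iM fine_timeE iM addrC addKr.
Qed.

End refined_scheme.

(** * The supermartingale of the refined scheme *)

Section regularity.
Context {R : realType} {d : nat}.

Lemma continuous_of_sqnorm_le (g : 'rV[R]_d -> R) (K : R) : 0 <= K ->
  (forall y z, (g y - g z) ^+ 2 <= K * sqnorm (y - z)) -> continuous g.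
Proof.
move=> K0 gK z; have FF : Filter (nbhs z) := nbhs_filter z.
suff : g y @[y --> z] --> g z by [].
apply/(@cvgrPdist_lt _ _ _ (nbhs z) FF g) => e e0.
have h : K * sqnorm (y - z) @[y --> z] --> (K * sqnorm (z - z) : R).
  apply: (@cvgM _ _ (nbhs z) FF); first exact: (@cvg_cst _ _ _ (nbhs z) FF).
  apply: (@cvg_sqnorm _ _ _ (nbhs z) FF).
  by apply: cvgB; [exact: cvg_id|exact: cvg_cst].
rewrite subrr (_ : sqnorm 0 = 0 :> R) ?mulr0 in h; last first.
  by rewrite sqnormE big1// => i _; rewrite mxE expr0n.
have e2 : 0 < e ^+ 2 by rewrite exprn_gt0.
have /(@cvgrPdist_lt _ _ _ (nbhs z) FF) /(_ _ e2) := h; apply: filterS => y.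
rewrite sub0r normrN ger0_norm ?mulr_ge0 ?sqnorm_ge0// => hy.
rewrite distrC -(@ltr_pXn2r _ 2)// ?nnegrE ?(ltW e0)//.
by rewrite real_normK ?num_real//; exact: le_lt_trans (gK y z) hy.
Qed.

Lemma sqr_coord_le_frobenius m n (D : 'M[R]_(m, n)) i j :
  D i j ^+ 2 <= frobenius D ^+ 2.
Proof.
rewrite frobenius_sqr (bigD1 i)//= (bigD1 j)//= -addrA lerDl addr_ge0//.
  by rewrite sumr_ge0// => l _; rewrite sqr_ge0.
by rewrite sumr_ge0// => l _; rewrite sumr_ge0// => l' _; rewrite sqr_ge0.
Qed.

Lemma globally_lipschitz_coord m n (f : 'rV[R]_d -> 'M[R]_(m, n)) i j :
  globally_lipschitz f -> continuous (fun y => f y i j).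
Proof.
move=> [K fK]; apply: (@continuous_of_sqnorm_le _ (K ^+ 2)); first exact: sqr_ge0.
move=> y z; have := sqr_coord_le_frobenius (f y - f z) i j; rewrite !mxE.
move/le_trans; apply; rewrite -enorm_sqr -exprMn.
rewrite lerXn2r ?nnegrE ?sqrtr_ge0//.
by apply: le_trans (fK y z); exact: sqrtr_ge0.
Qed.

Lemma flow_continuous (A : 'rV[R]_d -> 'rV[R]_d) (Phi : R -> 'rV[R]_d -> 'rV[R]_d)
    (L s : R) : is_flow A Phi ->
  (forall x y, dotp (A x - A y) (x - y) <= L * enorm (x - y) ^+ 2) -> 0 <= s ->
  continuous (Phi s).
Proof.
move=> hPhi mono s0 y.
apply: (@cvg_rV _ _ _ (nbhs y) (nbhs_filter y)) => i.
apply: (@continuous_of_sqnorm_le (fun y => Phi s y 0 i) (expR (2 * L * s))).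
  exact: expR_ge0.
move=> u v; apply: le_trans (flow_lipschitz hPhi u v mono s0).
have := sqr_coord_le_frobenius (Phi s u - Phi s v) 0 i.
by rewrite !mxE -enorm_sqr.
Qed.

End regularity.

Section scheme_supermartingale.
Context {R : realType} {d : nat}.

Lemma measurable_mixture dT (T : measurableType dT) (th be tau nu : R) N
    (f : T -> 'rV[R]_d) :
  (forall i, measurable_fun setT (fun w => f w 0 i)) ->
  measurable_fun setT (fun w => mixture d th be N tau (nu * sqnorm (f w))).
Proof.
move=> mf; apply: measurable_sum => k.
do 2 apply: measurable_funM => //.
apply: measurableT_comp => //; apply: measurable_funM => //.
apply: measurable_funM => //; apply: measurable_funM => //.
by apply: measurable_sum => i; exact: measurable_funM.
Qed.

Lemma brownian_gaussian_increment disp (Omega : measurableType disp)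
    (P : probability Omega R) (B : R -> Omega -> 'rV[R]_d) (s t : R) :
  brownian_motion P B -> 0 <= s -> s < t ->
  gaussian_increment P (t - s) (fun w => B t w - B s w).
Proof.
move=> [mB _ _ law] s0 st; have [indep lawi] := law s t s0 st; split => // i.
have mBi u : 0 <= u -> measurable_fun setT (fun w => B u w 0 i).
  by move=> u0; exact: measurableT_comp (measurable_coord i) (mB u u0).
under eq_fun do rewrite !mxE.
by apply: measurable_funB; apply: mBi => //; rewrite (le_trans s0)// ltW.
Qed.

Variables (disp : measure_display) (Omega : measurableType disp).
Variables (P : probability Omega R) (B : R -> Omega -> 'rV[R]_d).
Variables (A a : 'rV[R]_d -> 'rV[R]_d) (b : 'rV[R]_d -> 'M[R]_d).
Variables (Phi : R -> 'rV[R]_d -> 'rV[R]_d).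

(** The compensated mixture along the fine grid. The rate [K] pays for the drift
    [a], and [K'] for the flow, which acts on the mixture at the nodes only. *)
Definition compensated_mixture (h : R) (M : nat) (nu eta be K K' : R) (N i : nat)
    (s : borel_rV R d * borel_rV R d) : R :=
  expR (- (K * fine_time h M i) - K' * (fine_time h M i - fine_elapsed h M i)) *
  mixture d (4 * eta * nu) be N (fine_elapsed h M i) (nu * sqnorm (s.2 : 'rV[R]_d)).

(** During a step each noise part advances the clock of the mixture by [dl], and at
    the end of the step the flow turns it back from [h] to [0]. *)
Lemma fine_scheme_maximal (L h nu eta be bt al K' p : R) (M N m : nat) x :
  brownian_motion P B -> is_flow A Phi ->
  (forall x y, dotp (A x - A y) (x - y) <= L * enorm (x - y) ^+ 2) ->
  globally_lipschitz a -> globally_lipschitz b ->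
  (forall y, sqnorm (a y) <= al ^+ 2) -> (forall y, frobenius (b y) ^+ 2 <= bt) ->
  0 <= bt -> bt < 2 * eta -> 0 <= nu -> 1 < be ->
  (forall N s y, 0 <= s ->
    mixture d (4 * eta * nu) be N 0 (nu * sqnorm (Phi s y)) <=
    expR (K' * s) * mixture d (4 * eta * nu) be N s (nu * sqnorm y)) ->
  0 < h -> (0 < M)%N -> 0 < p < 1 ->
  let K := al ^+ 2 / (2 * (2 * eta - bt)) in
  let G := compensated_mixture h M nu eta be K K' N.+1 in
  let rmax w := running_max
    (fun i => G i (fine_state Phi a b h x M (B^~ w) i)) m in
  measurable_fun setT rmax /\
  (\int[P]_w (rmax w `^ p)%:E <=
   ((1 - p)^-1 * mixture d (4 * eta * nu) be N.+1 0 (nu * sqnorm x) `^ p)%:E)%E.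
Proof.
move=> hB hPhi mono lipa lipb aal bbt bt0 bteta nu0 be1 hflow h0 M0 p01 K G rmax.
pose dl := h / M%:R; have dl0 : 0 < dl by rewrite divr_gt0// ltr0n.
pose th := 4 * eta * nu.
have th0 : 0 <= th by rewrite mulr_ge0// mulr_ge0//; lra.
have time0 i : 0 <= fine_time h M i by rewrite mulr_ge0// ltW.
have elapsed0 i : 0 <= fine_elapsed h M i by rewrite mulr_ge0// ltW.
pose X i w : borel_rV R d := B (fine_time h M i.+1) w - B (fine_time h M i) w.
have hX i : gaussian_increment P dl (X i).
  have ti : fine_time h M i < fine_time h M i.+1.
    by rewrite fine_timeS ltrDl.
  have := brownian_gaussian_increment hB (time0 i) ti.
  by rewrite [X in gaussian_increment _ X](_ : _ = dl)// fine_timeS addrC addKr.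
have mX i : measurable_fun setT (X i).
  by apply: measurable_fun_borel_rV; case: (hX i).
have indep : mutually_independent P (fun i : 'I_m => X i).
  by have [_ _ + _] := hB; apply => // k; rewrite fine_timeS lerDl ltW.
have ma i : measurable_fun [set: borel_rV R d] (fun y => a y 0 i).
  by apply: continuous_measurable_borel_rV; exact: globally_lipschitz_coord.
have mb i j : measurable_fun [set: borel_rV R d] (fun y => b y i j).
  by apply: continuous_measurable_borel_rV; exact: globally_lipschitz_coord.
have mPhi : measurable_fun [set: borel_rV R d] (Phi h : borel_rV R d -> borel_rV R d).
  by apply: continuous_measurable_borel_rV2; apply: flow_continuous hPhi mono (ltW h0).
pose S : measurableType _ := (borel_rV R d * borel_rV R d)%type.
pose F i (s : S * borel_rV R d) : S := fine_update Phi a b h M i s.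
have my : measurable_fun [set: S * borel_rV R d]
    (fun s => (s.1.2 + dl *: a s.1.1 + s.2 *m (b s.1.1)^T : borel_rV R d)).
  apply: measurable_fun_borel_rV => i.
  under eq_fun do rewrite !mxE.
  have m11 : measurable_fun [set: S * borel_rV R d] (fun s => s.1.1).
    exact: measurableT_comp measurable_fst measurable_fst.
  have m12 : measurable_fun [set: S * borel_rV R d] (fun s => s.1.2).
    exact: measurableT_comp measurable_snd measurable_fst.
  apply: measurable_funD.
    apply: measurable_funD; first exact: measurableT_comp (measurable_coord i) m12.
    by apply: measurable_funM => //; exact: measurableT_comp (ma i) m11.
  apply: measurable_sum => j; apply: measurable_funM.
    exact: measurableT_comp (measurable_coord j) measurable_snd.
  under eq_fun do rewrite mxE.
  exact: measurableT_comp (mb i j) m11.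
have mF i : measurable_fun setT (F i).
  rewrite /F /fine_update -/dl; case: (M %| i.+1)%N.
    by apply: measurable_fun_pair; exact: measurableT_comp mPhi my.
  apply: measurable_fun_pair => //.
  exact: measurableT_comp measurable_fst measurable_fst.
have mG i : measurable_fun setT (G i).
  apply: measurable_funM => //; apply: measurable_mixture => j.
  exact: measurableT_comp (measurable_coord j) measurable_snd.
have G0 i s : 0 < G i s.
  rewrite mulr_gt0 ?expR_gt0// (lt_le_trans ltr01)//.
  exact: mixture_ge1.
have super i s : (i < m)%N ->
    (\int[P]_w (G i.+1 (F i (s, X i w)))%:E <= (G i s)%:E)%E.
  move=> _; case: s => z y.
  pose c := expR (- (K * fine_time h M i.+1) -
    K' * (fine_time h M i - fine_elapsed h M i)).
  pose Y w := y + dl *: a z + X i w *m (b z)^T.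
  have GY w : G i.+1 (F i ((z, y), X i w)) <=
      c * mixture d th be N.+1 (fine_elapsed h M i + dl) (nu * sqnorm (Y w)).
    rewrite /G /compensated_mixture /F /fine_update /= -/dl -/(Y w) fine_elapsedS.
    case: ifPn => Mi; last first.
      rewrite /= /c !fine_timeS.
      rewrite le_eqVlt; apply/orP; left; apply/eqP; congr (expR _ * _).
      by rewrite -/dl; ring.
    rewrite /= subr0 -/dl.
    have hE : fine_elapsed h M i + dl = h by exact: fine_elapsed_node.
    apply: le_trans.
      apply: ler_wpM2l; first exact: expR_ge0.
      exact: hflow (ltW h0).
    rewrite mulrA -expRD hE.
    rewrite le_eqVlt; apply/orP; left; apply/eqP; congr (expR _ * _).
    by rewrite -[in K' * h]hE !fine_timeS -/dl; ring.
  have mY : measurable_fun setT (fun w =>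
      mixture d th be N.+1 (fine_elapsed h M i + dl) (nu * sqnorm (Y w))).
    apply: measurable_mixture => j; rewrite /Y; under eq_fun do rewrite !mxE.
    have [mXi _ _] := hX i.
    apply: measurable_funD => //; apply: measurable_sum => k.
    by apply: measurable_funM.
  have edl0 : 0 <= fine_elapsed h M i + dl by rewrite addr_ge0// ltW.
  apply: (@le_trans _ _ (\int[P]_w (c%:E *
    (mixture d th be N.+1 (fine_elapsed h M i + dl) (nu * sqnorm (Y w)))%:E))%E).
    apply: ge0_le_integral => //.
    - by move=> w _; rewrite lee_fin ltW.
    - apply/measurable_EFinP; apply: measurableT_comp (mG i.+1) _.
      by apply: measurableT_comp (mF i) _; exact: measurable_fun_pair.
    - by apply: emeasurable_funM => //; exact/measurable_EFinP.
    - by move=> w _; rewrite -EFinM lee_fin.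
  rewrite ge0_integralZl ?lee_fin ?expR_ge0//; first last.
  - by move=> w _; rewrite lee_fin; exact: mixture_ge0.
  - exact/measurable_EFinP.
  have step := mixture_gaussian_step N.+1 y dl0 (hX i) nu0 be1 (elapsed0 i) bt0
    bteta (bbt z) (aal z).
  apply: le_trans.
    by apply: lee_wpmul2l step; rewrite lee_fin expR_ge0.
  rewrite -EFinM lee_fin mulrA -expRD /G /compensated_mixture /=.
  rewrite le_eqVlt; apply/orP; left; apply/eqP; congr (expR _ * _).
  by rewrite fine_timeS -/dl -/K; ring.
have St0 w : fine_state Phi a b h x M (B^~ w) 0 = (x, x) by rewrite fine_state0.
have StS i w : fine_state Phi a b h x M (B^~ w) i.+1 =
    F i (fine_state Phi a b h x M (B^~ w) i, X i w).
  exact: fine_stateS.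
have G00 : G 0%N (x, x) = mixture d (4 * eta * nu) be N.+1 0 (nu * sqnorm x).
  rewrite /G /compensated_mixture /fine_time /fine_elapsed mod0n !mul0r subrr !mulr0.
  by rewrite oppr0 addr0 expR0 mul1r.
rewrite -G00.
exact: (@chain_maximal_le _ _ _ Omega S (borel_rV R d) R P m X
  (fun i w => fine_state Phi a b h x M (B^~ w) i) (x, x) F G p
  mX indep mF St0 StS mG G0 super p01).
Qed.

End scheme_supermartingale.

(** * Limits along refined grids *)

Section limits.
Import HBNNSimple.
Context {R : realType}.
Local Open Scope ereal_scope.

Lemma limn_esup_le_near (u : (\bar R)^nat) (c : \bar R) :
  (\forall n \near \oo, u n <= c) -> limn_esup u <= c.
Proof.
move=> uc; apply: (@le_trans _ _ (ereal_sup (u @` [set n | u n <= c]))).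
  by apply: ereal_inf_lbound; exists [set n | u n <= c].
by apply: ge_ereal_sup => _ [n /= un <-].
Qed.

Lemma limn_einf_ge_near (u : (\bar R)^nat) (c : \bar R) :
  (\forall n \near \oo, c <= u n) -> c <= limn_einf u.
Proof.
move=> uc; rewrite /limn_einf leeNr; apply: limn_esup_le_near.
by apply: filterS uc => n un; rewrite leeN2.
Qed.

Lemma cvg_le_limn_einf (v : R^nat) (l : R) (u : (\bar R)^nat) :
  v n @[n --> \oo] --> l -> (\forall n \near \oo, (v n)%:E <= u n) ->
  l%:E <= limn_einf u.
Proof.
move=> vl vu; apply/lee_subgt0Pr => e e0; apply: limn_einf_ge_near.
near=> n; apply: (@le_trans _ _ (v n)%:E); last by near: n.
rewrite -EFinB lee_fin.
have : (`|l - v n| < e)%R by near: n; move/cvgrPdist_lt : vl; exact.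
by rewrite ltr_norml; lra.
Unshelve. all: by end_near. Qed.

Lemma measurable_limn_einf d (T : measurableType d) (f : (T -> \bar R)^nat) :
  (forall n, measurable_fun setT (f n)) ->
  measurable_fun setT (fun w => limn_einf (f ^~ w)).
Proof.
move=> mf; apply: measurableT_comp => //; apply: measurable_fun_limn_esup => // n.
exact: measurableT_comp.
Qed.

(** The integral of a nonnegative function is a lower integral, hence monotone
    without any measurability of the smaller function. *)
Lemma lower_integral_le d (T : measurableType d) (mu : {measure set T -> \bar R})
    (f g : T -> \bar R) : (forall w, 0 <= f w) -> (forall w, 0 <= g w) ->
  measurable_fun setT g -> {ae mu, forall w, f w <= g w} ->
  \int[mu]_w f w <= \int[mu]_w g w.
Proof.
move=> f0 g0 mg fg; rewrite [leLHS]ge0_integralTE//.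
apply: ge_ereal_sup => _ [k /= kf <-].
rewrite -integralT_nnsfun; apply: ae_ge0_le_integral => //.
- by move=> w _; rewrite lee_fin; exact: fun_ge0.
- exact/measurable_EFinP/measurable_funP.
- by apply: filterS fg => w fgw _; exact: le_trans (kf w) fgw.
Qed.

End limits.

Section right_continuous_paths.
Context {R : realType} {d : nat}.

(** Right-continuity at [t], tested along sequences that may touch [t]. *)
Lemma right_cvg_seq (f : R -> 'rV[R]_d) (t : R) (s : R^nat) :
  f u @[u --> t^'+] --> f t -> (forall n, t <= s n) -> s n @[n --> \oo] --> t ->
  f (s n) @[n --> \oo] --> f t.
Proof.
move=> ft st sn; apply/cvgrPdist_lt => e e0.
move/cvgrPdist_lt : ft => /(_ _ e0) [/= r r0 fr].
move/cvgrPdist_lt : sn => /(_ _ r0); apply: filterS => n tn.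
have := st n; rewrite le_eqVlt => /predU1P[<-|tsn]; first by rewrite subrr normr0.
by apply: fr.
Qed.

Lemma flow_cvg (A : 'rV[R]_d -> 'rV[R]_d) (Phi : R -> 'rV[R]_d -> 'rV[R]_d)
    (L t : R) (s : R^nat) (y : nat -> 'rV[R]_d) (z : 'rV[R]_d) :
  is_flow A Phi ->
  (forall x y, dotp (A x - A y) (x - y) <= L * enorm (x - y) ^+ 2) ->
  0 <= t -> (forall n, t <= s n) -> s n @[n --> \oo] --> t ->
  y n @[n --> \oo] --> z -> Phi (s n) (y n) @[n --> \oo] --> Phi t z.
Proof.
move=> hPhi mono t0 ts st yz.
have h1 : Phi (s n) z @[n --> \oo] --> Phi t z.
  apply: (@right_cvg_seq (fun u => Phi u z)) => //.
  move: t0; rewrite le_eqVlt => /predU1P[<-|t0].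
    exact: (flow_right_continuous hPhi).
  apply: cvg_at_right_filter.
  apply/differentiable_continuous/derivable1_diffP.
  by apply: ex_derive; exact: (flow_derive hPhi).
have h2 : Phi (s n) (y n) - Phi (s n) z @[n --> \oo] --> (0 : 'rV[R]_d).
  apply: sqnorm_cvg0; under eq_cvg do rewrite subr0.
  have h3 : expR (2 * L * s n) * sqnorm (y n - z) @[n --> \oo] -->
      expR (2 * L * t) * sqnorm (z - z).
    apply: cvgM.
      apply: (continuous_cvg _ (@continuous_expR _ _)).
      by apply: cvgM; [exact: cvg_cst|].
    by apply: cvg_sqnorm; apply: cvgB => //; exact: cvg_cst.
  rewrite subrr (_ : sqnorm 0 = 0 :> R) ?mulr0 in h3; last first.
    by rewrite sqnormE big1// => i _; rewrite mxE expr0n.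
  apply: (squeeze_cvgr _ (cvg_cst 0) h3); apply: nearW => n.
  rewrite sqnorm_ge0/=.
  exact: (flow_lipschitz hPhi _ _ mono (le_trans t0 (ts n))).
rewrite (_ : (fun n => Phi (s n) (y n)) =
    fun n => (Phi (s n) (y n) - Phi (s n) z) + Phi (s n) z); last first.
  by apply/funext => n; rewrite subrK.
by rewrite -[X in _ --> X]add0r; exact: cvgD.
Qed.

End right_continuous_paths.

Section splitting_limit.
Context {R : realType} {d : nat}.

Lemma cvg_mulmx (y : nat -> 'rV[R]_d) (z : 'rV[R]_d) (D : 'M[R]_d) :
  y n @[n --> \oo] --> z -> y n *m D @[n --> \oo] --> z *m D.
Proof.
move=> yz; apply: cvg_rV => i.
rewrite (_ : (fun n => (y n *m D) 0 i) = (fun n => \sum_j y n 0 j * D j i)); last first.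
  by apply/funext => n; rewrite mxE.
rewrite mxE; apply: cvg_sum_ord => j; apply: cvgM; last exact: cvg_cst.
exact: (continuous_cvg _ (@coord_continuous _ _ _ 0 j z) yz).
Qed.

Variables (A : 'rV[R]_d -> 'rV[R]_d) (Phi : R -> 'rV[R]_d -> 'rV[R]_d).
Variables (a : 'rV[R]_d -> 'rV[R]_d) (b : 'rV[R]_d -> 'M[R]_d).

Lemma splitting_step_cvg (L : R) (B : R -> 'rV[R]_d) (z : 'rV[R]_d) (c t : R)
    (s : R^nat) : is_flow A Phi ->
  (forall x y, dotp (A x - A y) (x - y) <= L * enorm (x - y) ^+ 2) ->
  B u @[u --> t^'+] --> B t -> c <= t -> (forall n, t <= s n) ->
  s n @[n --> \oo] --> t ->
  splitting_step Phi a b B z c (s n) @[n --> \oo] --> splitting_step Phi a b B z c t.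
Proof.
move=> hPhi mono Bt ct ts st; rewrite /splitting_step.
have sct : s n - c @[n --> \oo] --> t - c by apply: cvgB => //; exact: cvg_cst.
apply: (flow_cvg hPhi mono) => //; first by rewrite subr_ge0.
  by move=> n; rewrite lerD2r.
apply: cvgD.
  apply: cvgD; first exact: cvg_cst.
  by apply: cvgZ => //; exact: cvg_cst.
apply: cvg_mulmx; apply: cvgB; last exact: cvg_cst.
exact: right_cvg_seq.
Qed.

(** The grid of the scheme consists of left-open intervals, except that [t = 0]
    belongs to the interval of index 0. *)
Lemma splitting_locate (T t : R) (n : nat) x (B : R -> 'rV[R]_d) :
  0 < T -> (0 < n)%N -> 0 <= t <= T -> let h := T / n%:R in
  exists k : nat, [/\ (k < n)%N, k%:R * h <= t, t <= k.+1%:R * h &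
    splitting Phi a b T n x B t =
    splitting_step Phi a b B (splitting_node Phi a b h x B k) (k%:R * h) t].
Proof.
move=> T0 n0 /andP[t0 tT] h.
have h0 : 0 < h by rewrite divr_gt0// ltr0n.
have nh : n%:R * h = T by rewrite mulrC divfK// pnatr_eq0 -lt0n.
move: t0; rewrite le_eqVlt => /predU1P[<-|t0].
  exists 0%N; split => //; rewrite ?mul0r ?mul1r ?(ltW h0)//.
  by rewrite /splitting /Defs.eta grid_index0 mul0r.
have [k kt tk] : exists2 k : nat, k%:R * h < t & t <= k.+1%:R * h.
  have /truncn_itv /andP[] : 0 <= t / h by rewrite divr_ge0// ltW.
  set N := Num.truncn _; rewrite ler_pdivlMr// ltr_pdivrMr// le_eqVlt.
  move=> /predU1P[tN _|Nt /ltW tN]; last by exists N.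
  case: N tN => [|N] tN; first by rewrite -tN mul0r ltxx in t0.
  by exists N; rewrite -tN// ltr_pM2r// ltr_nat.
exists k; split => //; first 1 last.
- exact: ltW.
- by rewrite /splitting /Defs.eta (grid_indexP h0 kt tk).
- by rewrite -(ltr_nat R) -(ltr_pM2r h0) nh (lt_le_trans kt).
Qed.

(** Within the step that contains [t], the grid points just after [t]. *)
Definition fine_index (h t : R) (k M : nat) : nat :=
  (k * M + minn (Num.truncn ((t - k%:R * h) / (h / M%:R))).+1 M)%N.

(** The minimum with [M] in [fine_index] keeps the point within the step when [t] is
    its right end point. *)
Lemma fine_indexP (h t : R) (k M : nat) : 0 < h -> (0 < M)%N ->
  k%:R * h <= t <= k.+1%:R * h ->
  [/\ (k * M <= fine_index h t k M <= k.+1 * M)%N,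
      t <= fine_time h M (fine_index h t k M) &
      fine_time h M (fine_index h t k M) <= t + h / M%:R].
Proof.
move=> h0 M0 /andP[kt tk].
have dl0 : 0 < h / M%:R by rewrite divr_gt0// ltr0n.
have Mdl : M%:R * (h / M%:R) = h by rewrite mulrC divfK// pnatr_eq0 -lt0n.
set r := minn (Num.truncn ((t - k%:R * h) / (h / M%:R))).+1 M.
have timeE : fine_time h M (fine_index h t k M) = k%:R * h + r%:R * (h / M%:R).
  by rewrite /fine_index -/r /fine_time natrD mulrDl natrM -mulrA Mdl.
have /truncn_itv /andP[r1 r2] : 0 <= (t - k%:R * h) / (h / M%:R).
  by rewrite divr_ge0 ?subr_ge0// ltW.
rewrite ler_pdivlMr// in r1; rewrite ltr_pdivrMr// in r2.
split.
- by rewrite /fine_index leq_addr/= mulSn addnC leq_add2r geq_minr.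
- rewrite timeE -lerBlDl /r /minn; case: ifP => _; first exact: ltW.
  by rewrite Mdl; rewrite -natr1 mulrDl mul1r in tk; rewrite lerBlDl.
- rewrite timeE.
  have : r%:R * (h / M%:R) <= (Num.truncn ((t - k%:R * h) / (h / M%:R))).+1%:R * (h / M%:R).
    by rewrite ler_pM2r// ler_nat geq_minl.
  rewrite -natr1 mulrDl mul1r => hr.
  by rewrite -lerBrDl; apply: le_trans hr _; rewrite addrAC lerD2r.
Qed.

Lemma fine_time_cvg (h t : R) (k : nat) : 0 < h -> k%:R * h <= t <= k.+1%:R * h ->
  fine_time h M.+1 (fine_index h t k M.+1) @[M --> \oo] --> t.
Proof.
move=> h0 kt.
have h1 : t + h / M.+1%:R @[M --> \oo] --> t + h * 0.
  apply: cvgD; first exact: cvg_cst.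
  by apply: cvgM; [exact: cvg_cst|exact: cvg_harmonic].
rewrite mulr0 addr0 in h1.
apply: (squeeze_cvgr _ (cvg_cst t) h1); apply: nearW => M.
by have [_ -> ->] := fine_indexP h0 (ltn0Sn M) kt.
Qed.

End splitting_limit.

(** * Exponential moments of the splitting scheme *)

Section key_bound.
Context {R : realType}.

Lemma le_mixture d (th be tau t : R) (N N' : nat) : 1 < be -> 0 <= th ->
  0 <= tau -> (N <= N')%N -> mixture d th be N tau t <= mixture d th be N' tau t.
Proof.
move=> be1 th0 tau0 /subnKC <-; rewrite /mixture big_split_ord/= lerDl.
by rewrite sumr_ge0// => i _; rewrite ltW// mix_term_gt0.
Qed.

Lemma cvg_mixture0 d (th be t : R) N (s : R^nat) :
  s n @[n --> \oo] --> t ->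
  mixture d th be N 0 (s n) @[n --> \oo] --> mixture d th be N 0 t.
Proof.
move=> st; apply: cvg_sum_ord => k.
rewrite mix_term0; under eq_cvg do rewrite mix_term0.
apply: (continuous_cvg _ (@continuous_expR _ _)).
apply: cvgB; last exact: cvg_cst.
by apply: cvgM => //; exact: cvg_cst.
Qed.

Lemma cvg_powR (s : R^nat) (l p : R) : 0 < l ->
  s n @[n --> \oo] --> l -> s n `^ p @[n --> \oo] --> l `^ p.
Proof.
move=> l0 sl; have cp : {for l, continuous (fun z : R => z `^ p)}.
  apply/differentiable_continuous/derivable1_diffP.
  by apply: ex_derive; exact: is_derive1_powR.
exact: (continuous_cvg _ cp sl).
Qed.

Lemma right_continuous_of_within d (f : R -> 'rV[R]_d) (t : R) :
  {within `[0, +oo[, continuous f} -> 0 <= t -> f u @[u --> t^'+] --> f t.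
Proof.
move=> /continuous_within_itvcyP[cf f0].
rewrite le_eqVlt => /predU1P[<-//|t0].
apply: cvg_at_right_filter.
by have := cf t; rewrite in_itv/= t0 => /(_ isT).
Qed.

(** The supremum of [V lambda] is a power [p < 1] of that of [V l'] with [lambda < l' <
    Lambda], and the maximal inequality controls the latter. The number of parts of
    a step and the number of terms of the mixture grow together: the grid points
    just after a given [t] converge to [t], where the paths are right-continuous,
    and the mixtures at these points eventually contain the term that is comparable
    to [V l'] at [t]. Fatou's lemma passes the bound on to [g]. A measurable
    majorant is provided, so that no measurability of the supremum over [t] is
    needed. *)
Lemma splitting_sup_bound (d : nat)
  (disp : measure_display) (Omega : measurableType disp) (P : probability Omega R)
  (B : R -> Omega -> 'rV[R]_d) (hB : brownian_motion P B)
  (A a : 'rV[R]_d -> 'rV[R]_d) (b : 'rV[R]_d -> 'M[R]_d)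
  (kappa Cdiss C_2 L : R)
  (hkappa : 1 < kappa) (hCdiss : 0 < Cdiss) (hC_2 : 0 < C_2)
  (hdiss : forall x, dotp (A x) x <= - Cdiss * enorm x `^ (1 + kappa) + C_2)
  (habnd : bounded_map a) (halip : globally_lipschitz a)
  (hbbnd : bounded_map b) (hblip : globally_lipschitz b)
  (Lambda := 2 * Cdiss / sup (range (fun x => frobenius (b x) ^+ 2)))
  (hLambda : 0 < Lambda)
  (hmono : forall x y, dotp (A x - A y) (x - y) <= L * enorm (x - y) ^+ 2)
  (Phi : R -> 'rV[R]_d -> 'rV[R]_d) (hPhi : is_flow A Phi)
  (V := fun (lambda : R) (y : 'rV[R]_d) =>
     expR (lambda / (1 + kappa) * enorm y `^ (1 + kappa))) (T lambda : R) :
  0 < T -> 0 < lambda < Lambda ->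
  exists2 C : R, 0 < C & forall (x : 'rV[R]_d) (n : nat), (0 < n)%N ->
    exists g : Omega -> \bar R, [/\ measurable_fun setT g,
      (forall w, 0 <= g w)%E,
      (\int[P]_w g w <= (C * V lambda x)%:E)%E &
      {ae P, forall w, forall t, 0 <= t <= T ->
        ((V lambda (splitting Phi a b T n x (B^~ w) t))%:E <= g w)%E}].
Proof.
move=> T0 /andP[l0 lL].
have [bt btE] : exists bt, bt = sup (range (fun x => frobenius (b x) ^+ 2)).
  by exists (sup (range (fun x => frobenius (b x) ^+ 2))).
have LE : Lambda = 2 * Cdiss / bt by rewrite /Lambda btE.
have bt0 : 0 < bt.
  rewrite ltNge; apply/negP => bt0; move: hLambda; rewrite LE ltNge => /negP; apply.
  by rewrite mulr_ge0_le0 ?invr_le0// mulr_ge0// ltW.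
have bbt y : frobenius (b y) ^+ 2 <= bt.
  rewrite btE; apply: ub_le_sup; last by exists y.
  case: hbbnd => K hK; exists (K ^+ 2) => _ [z _ <-].
  by rewrite lerXn2r ?nnegrE ?sqrtr_ge0// (le_trans _ (hK z))// sqrtr_ge0.
have [al aal] : exists al, forall y, sqnorm (a y) <= al ^+ 2.
  case: habnd => K hK; exists K => y; rewrite -enorm_sqr.
  by rewrite lerXn2r ?nnegrE ?sqrtr_ge0// (le_trans _ (hK y))// sqrtr_ge0.
(* leaves room for the maximal inequality, which loses a power [p < 1] *)
have [l' ll' l'L] : exists2 l', lambda < l' & l' < 2 * Cdiss / bt.
  by exists ((lambda + Lambda) / 2); rewrite -?LE; lra.
have l'0 : 0 < l' by apply: lt_trans ll'.
have l'bt : bt / 2 < Cdiss / l'.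
  by rewrite ltr_pdivrMr// mulrAC ltr_pdivlMr//; rewrite ltr_pdivlMr// in l'L; lra.
(* the covariance of the artificial noise: larger than the actual one, and small
   enough for the dissipation at the exponent [l'] *)
have [eta eta1 eta2] : exists2 eta, bt / 2 < eta & eta < Cdiss / l'.
  by exists ((bt / 2 + Cdiss / l') / 2); lra.
have eta0 : 0 < eta by lra.
have etal : eta * l' < Cdiss by rewrite -ltr_pdivlMr.
have bteta : bt < 2 * eta by lra.
have [p pE] : exists p, p = lambda / l' by exists (lambda / l').
have p0 : 0 < p by rewrite pE divr_gt0.
have p01 : 0 < p < 1 by rewrite p0 pE ltr_pdivrMr// mul1r.
have p1 : 0 < 1 - p by case/andP: p01; lra.
have [be beE] : exists be, be = (1 + kappa) / 2 by exists ((1 + kappa) / 2).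
have [nu nuE] : exists nu, nu = (l' / (1 + kappa)) `^ (2 / (1 + kappa)).
  by exists ((l' / (1 + kappa)) `^ (2 / (1 + kappa))).
have nu0 : 0 <= nu by rewrite nuE powR_ge0.
have be1 : 1 < be by rewrite beE; lra.
have [K' K'0 hflow] :=
  flow_mixture hkappa hC_2 l'0 eta0 etal hdiss hPhi beE nuE.
have [th thE] : exists th, th = 4 * eta * nu by exists (4 * eta * nu).
rewrite -thE in hflow.
have th0 : 0 <= th by rewrite thE mulr_ge0// mulr_ge0// ltW.
pose K := al ^+ 2 / (2 * (2 * eta - bt)).
have K0 : 0 <= K by rewrite divr_ge0 ?sqr_ge0//; lra.
have [Cu Cu0 hCu] := mixture_upper be1.
pose jf (y : 'rV[R]_d) := (nu * sqnorm y) `^ (be / 2).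
have nus0 (y : 'rV[R]_d) : 0 <= nu * sqnorm y by rewrite mulr_ge0// sqnorm_ge0.
have jf0 y : 0 <= jf y by exact: powR_ge0.
have jft y : jf y `^ (2 / be) = nu * sqnorm y.
  by rewrite /jf -powRrM (_ : be / 2 * (2 / be) = 1) ?powRr1//; field; lra.
have jf2 y : jf y ^+ 2 = l' / (1 + kappa) * enorm y `^ (1 + kappa).
  rewrite -(@powR_mulrn _ _ 2)// /jf -powRrM divfK// nuE beE.
  exact: scaled_sqnorm_powR.
have VE y : V lambda y = expR (jf y ^+ 2) `^ p.
  rewrite /V jf2 -expRM; congr expR; rewrite pE [RHS]mulrAC.
  by congr (_ * _); rewrite [RHS]mulrC mulrA (divfK (lt0r_neq0 l'0)).
pose Eg := expR ((K + K') * T).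
have Eg0 : 0 < Eg by exact: expR_gt0.
have Egp0 : 0 < Eg `^ p by exact: powR_gt0.
pose c := (expR 3 * Eg) `^ p.
have c0 : 0 < c by rewrite powR_gt0// mulr_gt0// expR_gt0.
exists (c * ((1 - p)^-1 * Cu `^ p)).
  by rewrite mulr_gt0// mulr_gt0 ?invr_gt0// powR_gt0.
move=> x n n0; pose h := T / n%:R.
have h0 : 0 < h by rewrite divr_gt0// ltr0n.
have nh : n%:R * h = T by rewrite mulrC divfK// pnatr_eq0 -lt0n.
pose G M := @compensated_mixture R d h M.+1 nu eta be K K' M.+1.
pose st M w := fine_state Phi a b h x M.+1 (B^~ w).
pose rmax M w := running_max (fun i => G M i (st M w i)) (n * M.+1).
have hmax M := @fine_scheme_maximal R d disp Omega P B A a b Phi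
  L h nu eta be bt al K' p M.+1 M (n * M.+1) x hB hPhi hmono halip hblip aal bbt
  (ltW bt0) bteta nu0 be1.
rewrite -thE -/K in hmax.
have {}hmax M := hmax M hflow h0 (ltn0Sn M) p01.
have mf M : measurable_fun setT (fun w => (rmax M w `^ p)%:E).
  by apply/measurable_EFinP; have [mr _] := hmax M;
    exact: (measurableT_comp (measurable_powR p) mr).
pose lim w := limn_einf (fun M => (rmax M w `^ p)%:E).
have lim0 w : (0 <= lim w)%E.
  by apply: limn_einf_ge_near; apply: nearW => M; rewrite lee_fin powR_ge0.
have mlim : measurable_fun setT lim by exact: measurable_limn_einf.
exists (fun w => c%:E * lim w)%E; split.
- exact: emeasurable_funM.
- by move=> w; rewrite mule_ge0// lee_fin ltW.
- rewrite ge0_integralZl ?lee_fin ?(ltW c0)// -mulrA EFinM.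
  rewrite lee_wpmul2l ?lee_fin ?(ltW c0)//.
  apply: (@le_trans _ _ (limn_einf (fun M => \int[P]_w (rmax M w `^ p)%:E))%E).
    by apply: fatou => // M w _; rewrite lee_fin powR_ge0.
  apply: le_trans (limn_einf_sup _) _; apply: limn_esup_le_near.
  apply: nearW => M; have [_ /le_trans] := hmax M; apply.
  rewrite lee_fin VE -[leRHS]mulrA -(powRM _ (ltW Cu0) (expR_ge0 _)).
  apply: ler_wpM2l; first by rewrite invr_ge0 ltW.
  apply: ge0_ler_powR; first exact: ltW.
  - by rewrite nnegrE; exact: mixture_ge0.
  - by rewrite nnegrE; exact: mulr_ge0 (ltW Cu0) (expR_ge0 _).
  - by rewrite -jft; exact: hCu.
- have [_ cB _ _] := hB.
  apply: filterS cB => w [_ cw] t t0T.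
  have /andP[t0 tT] := t0T.
  have [k [kn kt tk ->]] := splitting_locate Phi a b x (B^~ w) T0 n0 t0T.
  rewrite -/h in kt tk *.
  have ktk : k%:R * h <= t <= k.+1%:R * h by rewrite kt tk.
  set node := splitting_node _ _ _ _ _ _ _.
  pose s M := fine_time h M.+1 (fine_index h t k M.+1).
  pose v M := splitting_step Phi a b (B^~ w) node (k%:R * h) (s M).
  have vcvg : v M @[M --> \oo] -->
      splitting_step Phi a b (B^~ w) node (k%:R * h) t.
    apply: (splitting_step_cvg hPhi hmono _ kt).
    - exact: right_continuous_of_within.
    - by move=> M; have [] := fine_indexP h0 (ltn0Sn M) ktk.
    - exact: fine_time_cvg.
  set Xt := splitting_step _ _ _ _ _ _ t in vcvg *.
  pose N := (Num.truncn (jf Xt)).+1.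
  have XN : jf Xt < N%:R by have /andP[] := truncn_itv (jf0 Xt).
  have lower : expR (jf Xt ^+ 2 - 3) <= mixture d th be N 0 (nu * sqnorm Xt).
    by rewrite -jft; exact: mixture_lower.
  have mix0 : 0 < mixture d th be N 0 (nu * sqnorm Xt).
    by apply: lt_le_trans lower; exact: expR_gt0.
  have mixcvg : mixture d th be N 0 (nu * sqnorm (v M)) `^ p / Eg `^ p @[M --> \oo] -->
      mixture d th be N 0 (nu * sqnorm Xt) `^ p / Eg `^ p.
    apply: cvgM; last exact: cvg_cst.
    apply: cvg_powR => //; apply: cvg_mixture0.
    by apply: cvgM; [exact: cvg_cst|exact: cvg_sqnorm].
  have bound M : mixture d th be M.+1 0 (nu * sqnorm (v M)) <= Eg * rmax M w.
    have [/andP[ki ik] _ _] := fine_indexP h0 (ltn0Sn M) ktk.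
    set i := fine_index _ _ _ _ in ki ik.
    have iN : (i <= n * M.+1)%N by rewrite (leq_trans ik)// leq_mul2r kn orbT.
    have vE : v M = Phi (fine_elapsed h M.+1 i) (st M w i).2.
      by rewrite /v /s fine_state_splitting ?ki//; exact: flow0 hPhi.
    have e0 : 0 <= fine_elapsed h M.+1 i.
      by rewrite mulr_ge0// divr_ge0// ltW.
    have tauT : fine_time h M.+1 i <= T.
      rewrite -nh -(fine_time_node h (ltn0Sn M)) /fine_time ler_wpM2r ?ler_nat//.
      by rewrite divr_ge0// ltW.
    rewrite vE; apply: le_trans (hflow _ _ _ e0) _.
    apply: (@le_trans _ _ (Eg * G M i (st M w i))); last first.
      by rewrite ler_pM2l//; exact: (le_running_max (fun i => G M i (st M w i)) iN).
    rewrite /G /compensated_mixture -thE mulrA /Eg -expRD.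
    apply: ler_wpM2r; first exact: mixture_ge0.
    rewrite ler_expR.
    rewrite -subr_ge0 (_ : _ - _ =
      (K + K') * (T - fine_time h M.+1 i)); last by ring.
    by apply: mulr_ge0; [exact: addr_ge0|rewrite subr_ge0].
  have rmax_bound : \forall M \near \oo,
      ((mixture d th be N 0 (nu * sqnorm (v M)) `^ p / Eg `^ p)%:E <=
       (rmax M w `^ p)%:E)%E.
    exists N => // M /= NM; rewrite lee_fin ler_pdivrMr//.
    have mixM : 0 <= mixture d th be N 0 (nu * sqnorm (v M)) by exact: mixture_ge0.
    have mixle : mixture d th be N 0 (nu * sqnorm (v M)) <= Eg * rmax M w.
      by apply: le_trans (bound M); apply: le_mixture => //; exact: leqW.
    have rmax0 : 0 <= rmax M w.
      by rewrite -(pmulr_rge0 _ Eg0); exact: le_trans mixM mixle.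
    rewrite [leRHS]mulrC -powRM ?(ltW Eg0)//.
    apply: ge0_ler_powR; rewrite ?nnegrE ?(ltW p0)//.
    by apply: mulr_ge0 => //; exact: ltW.
  have lim_ge := cvg_le_limn_einf mixcvg rmax_bound.
  apply: (@le_trans _ _ (c%:E *
     (mixture d th be N 0 (nu * sqnorm Xt) `^ p / Eg `^ p)%:E)%E); last first.
    by rewrite lee_wpmul2l// lee_fin ltW.
  rewrite -EFinM lee_fin VE /c powRM ?expR_ge0 ?(ltW Eg0)//.
  have cancel (u q z : R) : q != 0 -> u * q * (z / q) = u * z.
    by move=> q0; rewrite mulrACA divff// mulr1.
  rewrite (cancel (expR 3 `^ p) _ _ (lt0r_neq0 Egp0)).
  rewrite -powRM ?expR_ge0 ?(ltW mix0)//.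
  apply: ge0_ler_powR; rewrite ?nnegrE ?(ltW p0) ?expR_ge0//.
    by apply: mulr_ge0; [exact: expR_ge0|exact: ltW].
  rewrite -ler_pdivrMl ?expR_gt0// -expRN -expRD.
  by rewrite addrC.
Qed.

End key_bound.

Theorem theorem1p8 (R : realType) (d : nat) (hd : (0 < d)%N)
  (disp : measure_display) (Omega : measurableType disp) (P : probability Omega R)
  (B : R -> Omega -> 'rV[R]_d) (hB : brownian_motion P B)
  (A a : 'rV[R]_d -> 'rV[R]_d) (b : 'rV[R]_d -> 'M[R]_d)
  (kappa Cdiss C_2 L chi C_3 eps C_4 : R)
  (* (i) *)
  (hAlip : locally_lipschitz A)
  (hkappa : 1 < kappa) (hCdiss : 0 < Cdiss) (hC_2 : 0 < C_2)
  (hdiss : forall x, dotp (A x) x <= - Cdiss * enorm x `^ (1 + kappa) + C_2)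
  (* (ii) *)
  (habnd : bounded_map a) (halip : globally_lipschitz a)
  (hbbnd : bounded_map b) (hblip : globally_lipschitz b)
  (Lambda := 2 * Cdiss / sup (range (fun x => frobenius (b x) ^+ 2)))
  (hLambda : 0 < Lambda)
  (* (iii) *)
  (hL : 0 < L)
  (hmono : forall x y, dotp (A x - A y) (x - y) <= L * enorm (x - y) ^+ 2)
  (* (iv) *)
  (hAC2 : C2 A) (hchi : 0 <= chi) (hC_3 : 0 < C_3)
  (hgrowth : forall x : 'rV[R]_d,
     frobenius (jacobian A x) <= C_3 * (1 + enorm x `^ chi))
  (heps : 0 < eps) (hC_4 : 0 < C_4)
  (hhess : forall x phi : 'rV[R]_d,
     eps * enorm phi *
       (\sum_(k < d) frobenius (hessian (fun y => A y 0 k) x) * `|phi 0 k|)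
     + dotp (phi *m jacobian A x) phi <= C_4 * enorm phi ^+ 2)
  (Phi : R -> 'rV[R]_d -> 'rV[R]_d) (hPhi : is_flow A Phi)
  (X := fun (T : R) (x : 'rV[R]_d) (n : nat) (t : R) (w : Omega) =>
     splitting Phi a b T n x (B^~ w) t)
  (V := fun (lambda : R) (y : 'rV[R]_d) =>
     expR (lambda / (1 + kappa) * enorm y `^ (1 + kappa))) :
  (forall T lambda : R, 0 < T -> 0 < lambda < Lambda ->
     exists2 C : R, 0 < C & forall x : 'rV[R]_d,
       (limn_esup (fun n : nat => ereal_sup
          [set 'E_P[fun w => V lambda (X T x n t w)] | t in `[0%R, T]%classic])
        <= (C * V lambda x)%:E)%E)
  /\
  (forall T lambda : R, 0 < T -> 0 < lambda < Lambda / 2 ->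
     exists2 C : R, 0 < C & forall x : 'rV[R]_d,
       (limn_esup (fun n : nat =>
          \int[P]_w ereal_sup
            [set (V lambda (X T x n t w))%:E | t in `[0%R, T]%classic])
        <= (C * V lambda x)%:E)%E).
Proof.
have key T lambda := @splitting_sup_bound R d disp Omega P B hB A a b kappa Cdiss
  C_2 L hkappa hCdiss hC_2 hdiss habnd halip hbbnd hblip hLambda hmono Phi hPhi
  T lambda.
have V0 lambda y : (0 <= (V lambda y)%:E)%E by rewrite lee_fin expR_ge0.
split=> T lambda T0 => [lL|/andP[l0 lL]].
  have [C C0 hC] := key T lambda T0 lL.
  exists C => // x; apply: limn_esup_le_near; exists 1%N => // n /= n0.
  have [g [mg g0 intg Xg]] := hC x n n0.
  apply: ge_ereal_sup => _ [t /= t0T <-]; apply: le_trans intg.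
  rewrite unlock; apply: lower_integral_le => //.
  by apply: filterS Xg => w; apply; move: t0T; rewrite in_itv.
have lL' : 0 < lambda < Lambda by rewrite l0/=; lra.
have [C C0 hC] := key T lambda T0 lL'.
exists C => // x; apply: limn_esup_le_near; exists 1%N => // n /= n0.
have [g [mg g0 intg Xg]] := hC x n n0.
apply: le_trans intg; apply: lower_integral_le => //.
  move=> w; apply: le_trans (V0 lambda (X T x n 0 w)) _.
  apply: ereal_sup_ubound; exists 0 => //=.
  by rewrite in_itv/= lexx ltW.
apply: filterS Xg => w Xgw; apply: ge_ereal_sup => _ [t /= t0T <-].
by apply: Xgw; move: t0T; rewrite in_itv.
Qed.
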